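(* (Oseen iteration.) Let $\bm f\in \bm H^{-1}(\Omega)$, $\bm g\in\bm L^2(\Omega)$, $\varphi\in H^{-1}(\Omega)$ and assume $$\sigma:=\frac{\lambda_2\|L\|_*}{C_{\min}^2}+\frac{\lambda_2\lambda_q\lambda_{\varphi}}{C_{\min}^2}+\frac{\lambda_2\lambda_q\lambda_{\varphi}}{C_{\min}}+\frac{\lambda_2\|L\|_*}{C_{\min}}<1.$$ Let $(\bm\eta_h,\xi_h,\theta_h)$ be the solution of the discrete problem (P$_h$) and $(\bm\eta_h^0,\xi_h^0,\theta_h^0)$ the initial value (both defined in the context), and for $n\ge1$ let $(\bm\eta_h^n,\xi_h^n,\theta_h^n)\in\bm D_h\times G_h\times Z_h$ be defined from $\bm\eta_h^{n-1}$ by: for all $(\bm\Phi_h,\chi_h,r_h)\in\bm D_h\times G_h\times Z_h$, $$\begin{aligned} &\mathcal A_0(\bm\eta_h^n,\bm\Phi_h)+\mathcal A_1(\bm\eta_h^{n-1},\bm\eta_h^{n},\bm\Phi_h)+\mathcal B(\xi_h^n,\bm\Phi_h)+\mathcal Q(\theta_h^n,\bm\Phi_h)=\langle\bm L,\bm\Phi_h\rangle,\\ &\mathcal B(\chi_h,\bm\eta_h^n)=0,\\ &e(\theta_h^n,r_h)+\mathcal H(\bm\eta_h^{n-1},\theta_h^{n},r_h)=\Psi(r_h). \end{aligned}$$ Then (with no further condition on $\sigma$) the method is stable: for all $n\ge0$, $$\|\nabla\theta_h^n\|_0\le\lambda_\varphi,\qquad \|\bm\eta_h^n\|_1\le \frac{\|L\|_*+\lambda_q\lambda_\varphi}{C_{\min}},$$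 and the iterative errors $z_{\bm\eta}^n=\bm\eta_h-\bm\eta_h^n$, $z_\xi^n=\xi_h-\xi_h^n$, $z_\theta^n=\theta_h-\theta_h^n$ satisfy, for all $n\ge0$, $$\|z_{\bm\eta}^n\|_1\le\sigma^{n+1}\frac{\|L\|_*+\lambda_q\lambda_\varphi}{C_{\min}},\qquad \|\nabla z_\theta^n\|_0\le\sigma^{n+1}\lambda_\varphi,\qquad \beta^*\|z_\xi^n\|_0\le (C_{\max}+3C_{\min})\,\sigma^{n+1}\frac{\|L\|_*+\lambda_q\lambda_\varphi}{C_{\min}}.$$
   Context: Setting. $\Omega\subset\mathbb R^d$, $d\in\{2,3\}$, is a bounded domain with Lipschitz-continuous boundary; $Pr,Ra,\kappa>0$ are constants, $\bm i$ is a fixed unit basis vector, and $\bm B\in \bm L^3(\Omega)$ is a given magnetic field. For $d=2$, vector fields are written as $(\vartheta_1,\vartheta_2,0)$ and $\bm B=(0,0,B_3)^T$. $(\cdot,\cdot)$ and $\|\cdot\|_0$ are the $L^2(\Omega)$ inner product and norm. Spaces: $\bm X=\bm H^1_0(\Omega)$, $E=S=L^2_0(\Omega)$ (mean-zero $L^2$ functions), $\bm Y=\bm H_0(\mathrm{div},\Omega)$ (vanishing normal trace), $Z=H^1_0(\Omega)$. Norms: $\|\bm K\|_{div}=(\|\bm K\|_0^2+\|\nabla\cdot\bm K\|_0^2)^{1/2}$, $\|(\bm w,\bm K)\|_1=(\|\nabla\bm w\|_0^2+\|\bm K\|_{div}^2)^{1/2}$ on $\bm X\times\bm Y$, $\|(q,\psi)\|_0=(\|q\|_0^2+\|\psi\|_0^2)^{1/2}$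 on $E\times S$. Forms: $a_s(\bm v,\bm w)=Pr(\nabla\bm v,\nabla\bm w)$, $a_m(\bm F,\bm K)=\kappa(\bm F,\bm K)$, $d(\bm K,\bm v)=-\kappa(\bm K\times\bm B,\bm v)$, $b_s(q,\bm v)=-Pr(q,\nabla\cdot\bm v)$, $b_m(\psi,\bm F)=-\kappa(\psi,\nabla\cdot\bm F)$, $e(\theta,r)=(\nabla\theta,\nabla r)$, $c(\bm u,\bm v,\bm w)=\tfrac12((\bm u\cdot\nabla)\bm v,\bm w)-\tfrac12((\bm u\cdot\nabla)\bm w,\bm v)$, $h(\bm u,\theta,r)=\tfrac12((\bm u\cdot\nabla)\theta,r)-\tfrac12((\bm u\cdot\nabla)r,\theta)$. Then $\mathcal A_0((\bm u,\bm J),(\bm v,\bm K))=a_s(\bm u,\bm v)+a_m(\bm J,\bm K)+d(\bm J,\bm v)-d(\bm K,\bm u)$; $\mathcal A_1((\bm w,\bm M),(\bm u,\bm J),(\bm v,\bm K))=c(\bm w,\bm u,\bm v)$; $\mathcal B((q,\psi),(\bm v,\bm K))=b_s(q,\bm v)+b_m(\psi,\bm K)$; $\mathcal Q(\theta,(\bm v,\bm K))=-Pr\,Ra\,(\theta\,\bm i,\bm v)$; $\mathcal H((\bm u,\bm J),\theta,r)=h(\bm u,\theta,r)$; $\langle\bm L,(\bm v,\bm K)\rangle=\langle\bm f,\bm v\rangle+\kappa(\bm g,\bm K)$; $\Psi(r)=\langle\varphi,r\rangle$. Constants: $C_\Omega,\lambda_1,\lambda_2>0$ depend only on $\Omega$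 and satisfy $\|v\|_0\le C_\Omega\|\nabla v\|_0$, $\|v\|_{L^6(\Omega)}\le\lambda_1\|\nabla v\|_0$, $\|v\|_{L^4(\Omega)}^2\le\lambda_2\|\nabla v\|_0^2$ for all $v$ in $\bm X$ and in $Z$. $C_{\min}=\min\{Pr,\kappa\}$, $C_{\max}=2\max\{Pr,\kappa,\kappa\lambda_1\|\bm B\|_{\bm L^3(\Omega)}\}$, $\lambda_q=Pr\,Ra\,C_\Omega^2$. $\|\bm f\|_{-1}=\sup_{\bm 0\ne\bm v\in\bm X}\langle\bm f,\bm v\rangle/\|\nabla\bm v\|_0$, $\|L\|_*=(\|\bm f\|_{-1}^2+\kappa^2\|\bm g\|_0^2)^{1/2}$, $\lambda_\varphi=\sup_{0\ne r\in Z}\langle\varphi,r\rangle/\|\nabla r\|_0$. Discretization. $\bm X_h\subseteq\bm X$, $E_h\subseteq E$, $\bm Y_h\subseteq\bm Y$, $S_h\subseteq S$, $Z_h\subseteq Z$ are conforming finite element spaces on a shape-regular, quasi-uniform simplicial mesh of size $h$, with $\nabla\cdot\bm Y_h\subseteq S_h$; $\bm D_h=\bm X_h\times\bm Y_h$, $G_h=E_h\times S_h$. They satisfy inf-sup conditions with constants independent of $h$: $\sup_{\bm 0\ne\bm w_h\in\bm X_h}b_s(p_h,\bm w_h)/\|\nabla\bm w_h\|_0\ge\beta_{s,h}\|p_h\|_0$ for $p_h\in E_h$, $\sup_{\bm 0\ne\bm K_h\in\bm Y_h}b_m(\phi_h,\bm K_h)/\|\bm K_h\|_{div}\ge\beta_{m,h}\|\phi_h\|_0$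 for $\phi_h\in S_h$; consequently there is $\beta^*>0$ with $\sup_{0\ne\bm\Phi_h\in\bm D_h}\mathcal B(\chi_h,\bm\Phi_h)/\|\bm\Phi_h\|_1\ge\beta^*\|\chi_h\|_0$ for all $\chi_h\in G_h$, and $\beta^*$ denotes such a constant. The standard approximation properties are also assumed: for some integers $k,l$ the best-approximation errors of $\bm u$ (in $H^1$), $p$ (in $L^2$), $\theta$ (in $H^1$) are $O(h^{\min\{\gamma,l\}})$ times $\|\bm u\|_{1+\gamma,\Omega},\|p\|_{\gamma,\Omega},\|\theta\|_{1+\gamma,\Omega}$, and those of $\phi$ (in $L^2$), $\bm J$ (in the div-norm) are $O(h^{\min\{\tau,k\}})$ times $\|\phi\|_{\tau,\Omega}$, $\|\bm J\|_{\tau,\Omega}+\|\nabla\cdot\bm J\|_{\tau,\Omega}$. Problem (P$_h$): find $\bm\eta_h=(\bm u_h,\bm J_h)\in\bm D_h$, $\xi_h=(p_h,\phi_h)\in G_h$, $\theta_h\in Z_h$ with, for all $(\bm\Phi_h,\chi_h,r_h)\in\bm D_h\times G_h\times Z_h$: $\mathcal A_0(\bm\eta_h,\bm\Phi_h)+\mathcal A_1(\bm\eta_h,\bm\eta_h,\bm\Phi_h)+\mathcal B(\xi_h,\bm\Phi_h)+\mathcal Q(\theta_h,\bm\Phi_h)=\langle\bm L,\bm\Phi_h\rangle$; $\mathcal B(\chi_h,\bm\eta_h)=0$; $e(\theta_h,r_h)+\mathcal H(\bm\eta_h,\theta_h,r_h)=\Psi(r_h)$. When $\sigma<1$ it has a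 unique solution, with $\|\bm\eta_h\|_1\le(\|L\|_*+\lambda_q\lambda_\varphi)/C_{\min}$ and $\|\nabla\theta_h\|_0\le\lambda_\varphi$. Initial value: $(\bm\eta_h^0,\xi_h^0,\theta_h^0)\in\bm D_h\times G_h\times Z_h$ is the unique solution of $\mathcal A_0(\bm\eta_h^0,\bm\Phi_h)+\mathcal B(\xi_h^0,\bm\Phi_h)+\mathcal Q(\theta_h^0,\bm\Phi_h)=\langle\bm L,\bm\Phi_h\rangle$, $\mathcal B(\chi_h,\bm\eta_h^0)=0$, $e(\theta_h^0,r_h)=\Psi(r_h)$ for all $(\bm\Phi_h,\chi_h,r_h)\in\bm D_h\times G_h\times Z_h$. *)

(* Defs.v *)
From HB Require Import structures.
From mathcomp Require Import all_boot all_order all_algebra.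
From mathcomp Require Import all_classical all_reals all_analysis.
Set Implicit Arguments.
Unset Strict Implicit.
Unset Printing Implicit Defensive.
Import Order.TTheory GRing.Theory Num.Theory.
Import numFieldNormedType.Exports.
Local Open Scope classical_set_scope.
Local Open Scope ring_scope.

(* The sigma-algebra of R^n = 'rV[R]_n is generated by the coordinates, hence
   it is the Borel one. *)
Definition rV_display : measure_display. Proof. exact: default_measure_display. Qed.

Section rV_measurable.
Context {R : realType} {n : nat}.
Let coords (i : 'I_n) (x : 'rV[R]_n) : R := x 0 i.
Let m0 : g_sigma_preimage coords set0. Proof. exact: sigma_algebra0. Qed.
Let mC A : g_sigma_preimage coords A -> g_sigma_preimage coords (~` A).
Proof. exact: sigma_algebraC. Qed.
Let mU (F : (set 'rV[R]_n)^nat) : (forall i, g_sigma_preimage coords (F i)) ->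
  g_sigma_preimage coords (\bigcup_i (F i)).
Proof. exact: sigma_algebra_bigcup. Qed.
HB.instance Definition _ := @isMeasurable.Build rV_display 'rV[R]_n
  (g_sigma_preimage coords) m0 mC mU.

Lemma measurable_coord (i : 'I_n) :
  measurable_fun [set: 'rV[R]_n] (fun x : 'rV[R]_n => x 0 i).
Proof.
move=> _ Y mY; rewrite setTI; apply: sub_sigma_algebra => /=.
rewrite -bigcup_seq/=; exists i => /=; first by rewrite mem_index_enum.
by exists Y => //; rewrite setTI.
Qed.

Lemma measurable_fun_coordP d (T : measurableType d) (f : T -> 'rV[R]_n) :
  (forall i, measurable_fun [set: T] (fun t => f t 0 i)) ->
  measurable_fun [set: T] f.
Proof.
move=> mf.
suff : @measurable _ 'rV[R]_n `<=` [set A | measurable (f @^-1` A)].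
  by move=> h _ A mA; rewrite setTI; exact: h.
apply: smallest_sub.
  split => /=.
  - by rewrite preimage_set0.
  - by move=> A mA; rewrite setTD preimage_setC; exact: measurableC.
  - by move=> F mF; rewrite preimage_bigcup; exact: bigcupT_measurable.
move=> A; rewrite -bigcup_seq => -[i _ [Y mY <-]] /=.
by have := mf i measurableT Y mY; rewrite !setTI.
Qed.

End rV_measurable.

(* Lebesgue measure on R^n, the n-fold product of that of R. *)
Section lebesgue_rV.
Context {R : realType}.

Definition rV_cons n (z : measurableTypeR R * 'rV[R]_n) : 'rV[R]_n.+1 :=
  \row_i (if unlift ord0 i is Some j then z.2 0 j else z.1).

Definition rV_uncons n (v : 'rV[R]_n.+1) : measurableTypeR R * 'rV[R]_n :=
  (v 0 ord0, \row_j v 0 (lift ord0 j)).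

Lemma measurable_rV_cons n : measurable_fun setT (@rV_cons n).
Proof.
apply: measurable_fun_coordP => i; rewrite /rV_cons.
under eq_fun do rewrite mxE.
case: unliftP => [j _|_]; last exact: measurable_fst.
exact: (measurableT_comp (measurable_coord j)).
Qed.

Lemma measurable_rV_uncons n : measurable_fun setT (@rV_uncons n).
Proof.
apply: measurable_fun_pair => /=; first exact: measurable_coord.
apply: measurable_fun_coordP => i.
under eq_fun do rewrite mxE.
exact: measurable_coord.
Qed.

Lemma rV_consK n : cancel (@rV_cons n) (@rV_uncons n).
Proof.
move=> [x v]; rewrite /rV_uncons /rV_cons mxE unlift_none /=; congr pair.
by apply/rowP => j; rewrite !mxE liftK.
Qed.

Definition product_rV n (mu : {sigma_finite_measure set 'rV[R]_n -> \bar R}) :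
  set 'rV[R]_n.+1 -> \bar R :=
  pushforward ((@lebesgue_measure R) \x mu)%E (@rV_cons n).

Section product_rV_measure.
Context {n : nat} (mu : {sigma_finite_measure set 'rV[R]_n -> \bar R}).
Local Open Scope ereal_scope.

Let product_rV0 : product_rV mu set0 = 0.
Proof. by rewrite /product_rV /pushforward preimage_set0 measure0. Qed.

Let product_rV_ge0 A : 0 <= product_rV mu A.
Proof. exact: (measure_ge0 (@lebesgue_measure R \x mu)). Qed.

Let measurable_pre A : measurable A -> measurable (@rV_cons n @^-1` A).
Proof. by move=> mA; rewrite -[X in measurable X]setTI; exact: measurable_rV_cons. Qed.

Let product_rV_sigma_additive : semi_sigma_additive (product_rV mu).
Proof.
move=> F mF tF mUF; rewrite /product_rV /pushforward preimage_bigcup.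
apply: measure_semi_sigma_additive.
- by move=> k; exact: measurable_pre.
- apply/trivIsetP => /= i j _ _ ij; rewrite -preimage_setI.
  by move/trivIsetP : tF => /(_ _ _ _ _ ij) ->//; rewrite preimage_set0.
- by rewrite -preimage_bigcup; exact: measurable_pre.
Qed.

HB.instance Definition _ := isMeasure.Build _ _ _ (product_rV mu)
  product_rV0 product_rV_ge0 product_rV_sigma_additive.


Let product_rV_sigma_finite : sigma_finite setT (product_rV mu).
Proof.
have /sigma_finiteP[F [TF ndF Foo]] := sigma_finiteT (@lebesgue_measure R).
have /sigma_finiteP[G [TG ndG Goo]] := sigma_finiteT mu.
exists (fun k => @rV_uncons n @^-1` (F k `*` G k)).
  apply/esym; rewrite -subTset => v _.
  have [i _ Fi] : (\bigcup_i F i) (rV_uncons v).1 by rewrite -TF.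
  have [j _ Gj] : (\bigcup_i G i) (rV_uncons v).2 by rewrite -TG.
  exists (maxn i j) => //; split => /=.
  - by move: Fi; exact/subsetPset/ndF/leq_maxl.
  - by move: Gj; exact/subsetPset/ndG/leq_maxr.
move=> k; have [mF Fk] := Foo k; have [mG Gk] := Goo k.
have mFG : measurable (F k `*` G k) by exact: measurableX.
split; first by rewrite -[X in measurable X]setTI; exact: measurable_rV_uncons.
rewrite /product_rV /pushforward.
rewrite (_ : _ @^-1` _ = F k `*` G k); last first.
  rewrite -comp_preimage (_ : _ \o _ = id) ?preimage_id//.
  by apply/funext => z; exact: rV_consK.
by rewrite product_measure1E// lte_mul_pinfty// ge0_fin_numE.
Qed.

HB.instance Definition _ := Measure_isSigmaFinite.Build _ _ _ (product_rV mu)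
  product_rV_sigma_finite.

End product_rV_measure.

Fixpoint lebesgue_rV n : {sigma_finite_measure set 'rV[R]_n -> \bar R} :=
  if n is m.+1 then product_rV (lebesgue_rV m) else \d_(0 : 'rV[R]_0).
End lebesgue_rV.

Notation "''e_' i" := (delta_mx 0 i) (at level 8, i at level 2, format "''e_' i").

(* Scalar and vector H^1 functions are pairs (function, weak gradient); H(div)
   fields are pairs (field, weak divergence). The second component is
   determined a.e. by the first one on the domain, and linear combinations are
   taken componentwise. The gradient of a vector field w is the matrix
   G x i j = d_i w_j, so that (u . nabla) w = u *m G for row vectors. *)
Notation h1_scalar R d :=
  (('rV[R]_d -> R) * ('rV[R]_d -> 'rV[R]_d))%type.
Notation h1_vector R d :=
  (('rV[R]_d -> 'rV[R]_d) * ('rV[R]_d -> 'M[R]_d))%type.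
Notation hdiv_vector R d :=
  (('rV[R]_d -> 'rV[R]_d) * ('rV[R]_d -> R))%type.
Notation flow_pair R d := (h1_vector R d * hdiv_vector R d)%type.
Notation pressure_pair R d := (('rV[R]_d -> R) * ('rV[R]_d -> R))%type.

Definition mxdot (R : realType) m n (A B : 'M[R]_(m, n)) : R :=
  \sum_i \sum_j A i j * B i j.

Definition mxnorm (R : realType) m n (A : 'M[R]_(m, n)) : R :=
  Num.sqrt (mxdot A A).

(* Dual norm sup { F v / N v | v in X, v <> 0 }, where N is the norm of X, so
   that v <> 0 in X means N v <> 0. *)
Definition dual_norm (R : realType) (V : Type) (N : V -> R) (X : set V)
    (F : V -> R) : R :=
  sup [set F v / N v | v in X `&` [set v | N v != 0]].

Definition is_dual (R : realType) (V : lmodType R) (N : V -> R) (X : set V)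
    (F : V -> R) : Prop :=
  (forall (a : R) u v, X u -> X v -> F (a *: u + v) = a * F u + F v) /\
  (exists C : R, forall v, X v -> `|F v| <= C * N v).

Definition fin_dim (R : realType) (V : lmodType R) (X : set V) : Prop :=
  exists (n : nat) (b : 'I_n -> V),
    X = [set \sum_i c i *: b i | c in [set: 'I_n -> R]].

(* Indices are taken modulo 3. *)
Definition cross (R : realType) (u v : 'rV[R]_3) : 'rV[R]_3 :=
  \row_k (u 0 (k + 1) * v 0 (k + 2) - u 0 (k + 2) * v 0 (k + 1)).

(* (v_1, v_2) |-> (v_1, v_2, 0) for d = 2, and the identity for d = 3. *)
Definition pad3 (R : realType) d (v : 'rV[R]_d) : 'rV[R]_3 :=
  \row_(k < 3) (if insub (k : nat) is Some j then v 0 (j : 'I_d) else 0).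

Section spaces.
Context {R : realType} {d : nat}.
Local Notation E := 'rV[R]_d.
Local Notation mu := (@lebesgue_rV R d).
Variable Omega : set E.

(* Near each boundary point, Omega is the strict epigraph, in some unit
   direction e, of a Lipschitz function over the hyperplane orthogonal to e. *)
Definition lipschitz_domain : Prop :=
  [/\ open Omega, connected Omega, Omega !=set0, bounded_set Omega &
    forall x, (closure Omega `\` Omega) x ->
      exists (e : E) (gamma : E -> R) (k : R),
        [/\ mxnorm e = 1, k.-lipschitz gamma &
          \forall y \near x,
            Omega y <-> gamma (y - mxdot y e *: e) < mxdot y e]].

Definition Lp (p : R) : set (E -> R) :=
  [set f | f \_ Omega \in Lfun mu p%:E].

Definition Lp_enorm (p : R) (f : E -> R) : \bar R :=
  'N[mu]_p%:E [EFin \o f \_ Omega].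

Definition Lp_norm (p : R) (f : E -> R) : R := fine (Lp_enorm p f).

Definition Lp_mx (p : R) m n : set (E -> 'M[R]_(m, n)) :=
  [set F | forall i j, Lp p (fun x => F x i j)].

Definition ip (f g : E -> R) : R := \int[mu]_(x in Omega) (f x * g x).

Definition ip_mx m n (F G : E -> 'M[R]_(m, n)) : R :=
  \int[mu]_(x in Omega) mxdot (F x) (G x).

Definition norm0 (f : E -> R) : R := Lp_norm 2 f.

Definition norm0_mx m n (F : E -> 'M[R]_(m, n)) : R :=
  norm0 (fun x => mxnorm (F x)).

Definition iter_partial (s : seq 'I_d) (phi : E -> R) : E -> R :=
  foldr (fun i (f : E -> R) x => 'D_('e_i) f x) phi s.

Definition smooth (phi : E -> R) : Prop :=
  forall s, continuous (iter_partial s phi) /\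
    forall i x, derivable (iter_partial s phi) x 'e_i.

Definition test_fun : set (E -> R) :=
  [set phi | smooth phi /\
    exists2 K, compact K /\ K `<=` Omega & forall x, ~ K x -> phi x = 0].

Definition grad (phi : E -> R) (x : E) : E := \row_i 'D_('e_i) phi x.

Definition H1 : set (h1_scalar R d) :=
  [set z | [/\ Lp 2 z.1, Lp_mx 2 z.2 &
    forall phi, test_fun phi -> forall i,
      ip z.1 (fun x => grad phi x 0 i) = - ip (fun x => z.2 x 0 i) phi]].

(* Closure of the test functions in H^1. *)
Definition H10 : set (h1_scalar R d) :=
  [set z | H1 z /\ forall eps : R, 0 < eps -> exists2 phi, test_fun phi &
    norm0 (fun x => z.1 x - phi x) < eps /\
    norm0_mx (fun x => z.2 x - grad phi x) < eps].

Definition H10_vec : set (h1_vector R d) :=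
  [set w : h1_vector R d | forall j, H10 (fun x => w.1 x 0 j, fun x => (col j (w.2 x))^T)].

Definition Hdiv : set (hdiv_vector R d) :=
  [set K | [/\ Lp_mx 2 K.1, Lp 2 K.2 &
    forall phi, test_fun phi -> ip_mx K.1 (grad phi) = - ip K.2 phi]].

(* The normal trace of K is the functional v |-> (K, grad v) + (div K, v) on
   H^1. *)
Definition H0div : set (hdiv_vector R d) :=
  [set K | Hdiv K /\ forall v, H1 v -> ip_mx K.1 v.2 + ip K.2 v.1 = 0].

Definition L20 : set (E -> R) :=
  [set q | Lp 2 q /\ \int[mu]_(x in Omega) q x = 0].

End spaces.

Record problem_data (R : realType) (d : nat) := ProblemData {
  Omega : set 'rV[R]_d;
  Pr : R;
  Ra : R;
  kappa : R;
  idir : 'I_d; (* the unit vector i is 'e_idir *)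
  Bfield : 'rV[R]_d -> 'rV[R]_3;
  fsrc : h1_vector R d -> R; (* f, g, phi of the right-hand sides *)
  gsrc : 'rV[R]_d -> 'rV[R]_d;
  phisrc : h1_scalar R d -> R
}.

Record fe_spaces (R : realType) (d : nat) := FESpaces {
  Xh : set (h1_vector R d);
  Yh : set (hdiv_vector R d);
  Eh : set ('rV[R]_d -> R);
  Sh : set ('rV[R]_d -> R);
  Zh : set (h1_scalar R d)
}.

Section forms.
Context {R : realType} {d : nat}.
Variable D : problem_data R d.
Local Notation Om := (Omega D).
Local Notation mu := (@lebesgue_rV R d).

Definition X_norm (v : h1_vector R d) : R := norm0_mx Om v.2.
Definition Z_norm (r : h1_scalar R d) : R := norm0_mx Om r.2.
Definition div_norm (K : hdiv_vector R d) : R :=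
  Num.sqrt (norm0_mx Om K.1 ^+ 2 + norm0 Om K.2 ^+ 2).
Definition flow_norm (Phi : flow_pair R d) : R :=
  Num.sqrt (X_norm Phi.1 ^+ 2 + div_norm Phi.2 ^+ 2).
Definition pressure_norm (chi : pressure_pair R d) : R :=
  Num.sqrt (norm0 Om chi.1 ^+ 2 + norm0 Om chi.2 ^+ 2).

Definition a_s (v w : h1_vector R d) : R := Pr D * ip_mx Om v.2 w.2.
Definition a_m (F K : hdiv_vector R d) : R := kappa D * ip_mx Om F.1 K.1.
Definition d_form (K : hdiv_vector R d) (v : h1_vector R d) : R :=
  - kappa D * ip_mx Om (fun x => cross (pad3 (K.1 x)) (Bfield D x))
                       (fun x => pad3 (v.1 x)).
Definition b_s (q : 'rV[R]_d -> R) (v : h1_vector R d) : R :=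
  - Pr D * ip Om q (fun x => \tr (v.2 x)).
Definition b_m (psi : 'rV[R]_d -> R) (F : hdiv_vector R d) : R :=
  - kappa D * ip Om psi F.2.
Definition e_form (theta r : h1_scalar R d) : R := ip_mx Om theta.2 r.2.
Definition c_form (u v w : h1_vector R d) : R :=
  2^-1 * ip_mx Om (fun x => u.1 x *m v.2 x) w.1
  - 2^-1 * ip_mx Om (fun x => u.1 x *m w.2 x) v.1.
Definition h_form (u : h1_vector R d) (theta r : h1_scalar R d) : R :=
  2^-1 * ip Om (fun x => mxdot (u.1 x) (theta.2 x)) r.1
  - 2^-1 * ip Om (fun x => mxdot (u.1 x) (r.2 x)) theta.1.

Definition A0 (eta Phi : flow_pair R d) : R :=
  a_s eta.1 Phi.1 + a_m eta.2 Phi.2 + d_form eta.2 Phi.1 - d_form Phi.2 eta.1.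
Definition A1 (omega eta Phi : flow_pair R d) : R :=
  c_form omega.1 eta.1 Phi.1.
Definition Bform (chi : pressure_pair R d) (Phi : flow_pair R d) : R :=
  b_s chi.1 Phi.1 + b_m chi.2 Phi.2.
Definition Qform (theta : h1_scalar R d) (Phi : flow_pair R d) : R :=
  - (Pr D * Ra D * ip_mx Om (fun x => theta.1 x *: 'e_(idir D)) Phi.1.1).
Definition Hform (eta : flow_pair R d) (theta r : h1_scalar R d) : R :=
  h_form eta.1 theta r.
Definition Lform (Phi : flow_pair R d) : R :=
  fsrc D Phi.1 + kappa D * ip_mx Om (gsrc D) Phi.2.1.

(* In dimension 2 the magnetic field is (0, 0, B_3). *)
Definition well_posed_data : Prop :=
  [/\ lipschitz_domain Om, [/\ 0 < Pr D, 0 < Ra D & 0 < kappa D],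
    Lp_mx Om 3 (Bfield D) /\
      (d = 2%N -> forall x (j : 'I_3), Om x -> (j < 2)%N -> Bfield D x 0 j = 0),
    is_dual X_norm (H10_vec Om) (fsrc D) /\ Lp_mx Om 2 (gsrc D) &
    is_dual Z_norm (H10 Om) (phisrc D)].

(* The L^4 and L^6 norms are extended reals here, so that membership of L^4 and
   L^6 is part of the inequalities. *)
Definition embedding_constants (COm lambda1 lambda2 : R) : Prop :=
  [/\ 0 < COm, 0 < lambda1, 0 < lambda2,
    forall v, H10_vec Om v ->
      [/\ norm0_mx Om v.1 <= COm * X_norm v,
        (Lp_enorm Om 6 (fun x => mxnorm (v.1 x)) <=
           (lambda1 * X_norm v)%:E)%E &
        (Lp_enorm Om 4 (fun x => mxnorm (v.1 x)) ^+ 2 <=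
           (lambda2 * X_norm v ^+ 2)%:E)%E] &
    forall r, H10 Om r ->
      [/\ norm0 Om r.1 <= COm * Z_norm r,
        (Lp_enorm Om 6 r.1 <= (lambda1 * Z_norm r)%:E)%E &
        (Lp_enorm Om 4 r.1 ^+ 2 <= (lambda2 * Z_norm r ^+ 2)%:E)%E]].

Definition Cmin : R := Num.min (Pr D) (kappa D).
Definition Cmax (lambda1 : R) : R :=
  2 * Num.max (Num.max (Pr D) (kappa D))
        (kappa D * lambda1 * Lp_norm Om 3 (fun x => mxnorm (Bfield D x))).
Definition lambda_q (COm : R) : R := Pr D * Ra D * COm ^+ 2.
Definition f_dual_norm : R := dual_norm X_norm (H10_vec Om) (fsrc D).
Definition L_norm : R :=
  Num.sqrt (f_dual_norm ^+ 2 + kappa D ^+ 2 * norm0_mx Om (gsrc D) ^+ 2).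
Definition lambda_phi : R := dual_norm Z_norm (H10 Om) (phisrc D).
Definition sigma (COm lambda2 : R) : R :=
  lambda2 * L_norm / Cmin ^+ 2
  + lambda2 * lambda_q COm * lambda_phi / Cmin ^+ 2
  + lambda2 * lambda_q COm * lambda_phi / Cmin
  + lambda2 * L_norm / Cmin.

Section discretization.
Variable V : fe_spaces R d.

Definition Dh : set (flow_pair R d) := Xh V `*` Yh V.
Definition Gh : set (pressure_pair R d) := Eh V `*` Sh V.

Definition conforming : Prop :=
  [/\ fin_dim (Xh V) /\ Xh V `<=` H10_vec Om,
    fin_dim (Yh V) /\ Yh V `<=` H0div Om,
    fin_dim (Eh V) /\ Eh V `<=` L20 Om,
    fin_dim (Sh V) /\ Sh V `<=` L20 Om &
    fin_dim (Zh V) /\ Zh V `<=` H10 Om] /\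
  (forall K, Yh V K -> exists2 psi, Sh V psi &
     {ae mu, forall x, Om x -> K.2 x = psi x}).

Definition inf_sup_s (beta : R) : Prop :=
  forall q, Eh V q -> beta * norm0 Om q <= dual_norm X_norm (Xh V) (b_s q).

Definition inf_sup_m (beta : R) : Prop :=
  forall psi, Sh V psi ->
    beta * norm0 Om psi <= dual_norm div_norm (Yh V) (b_m psi).

Definition inf_sup (beta : R) : Prop :=
  forall chi, Gh chi ->
    beta * pressure_norm chi <= dual_norm flow_norm Dh (Bform chi).

Definition discrete_solution (eta : flow_pair R d) (xi : pressure_pair R d)
    (theta : h1_scalar R d) : Prop :=
  [/\ Dh eta, Gh xi, Zh V theta &
    forall Phi chi r, Dh Phi -> Gh chi -> Zh V r ->
    [/\ A0 eta Phi + A1 eta eta Phi + Bform xi Phi + Qform theta Phi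
          = Lform Phi,
      Bform chi eta = 0 &
      e_form theta r + Hform eta theta r = phisrc D r]].

Definition initial_solution (eta : flow_pair R d) (xi : pressure_pair R d)
    (theta : h1_scalar R d) : Prop :=
  [/\ Dh eta, Gh xi, Zh V theta &
    forall Phi chi r, Dh Phi -> Gh chi -> Zh V r ->
    [/\ A0 eta Phi + Bform xi Phi + Qform theta Phi = Lform Phi,
      Bform chi eta = 0 &
      e_form theta r = phisrc D r]].

Definition oseen_step (eta' eta : flow_pair R d) (xi : pressure_pair R d)
    (theta : h1_scalar R d) : Prop :=
  [/\ Dh eta, Gh xi, Zh V theta &
    forall Phi chi r, Dh Phi -> Gh chi -> Zh V r ->
    [/\ A0 eta Phi + A1 eta' eta Phi + Bform xi Phi + Qform theta Phi
          = Lform Phi,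
      Bform chi eta = 0 &
      e_form theta r + Hform eta' theta r = phisrc D r]].

End discretization.
End forms.

(* Main.v *)
Require Import Defs.
From mathcomp Require Import all_boot all_order all_algebra.
From mathcomp Require Import all_classical all_reals all_analysis.
From mathcomp Require Import measurable_realfun ring lra.
Set Implicit Arguments.
Unset Strict Implicit.
Unset Printing Implicit Defensive.
Import Order.TTheory GRing.Theory Num.Theory.
Import numFieldNormedType.Exports.
Local Open Scope classical_set_scope.
Local Open Scope ring_scope.

(** The convective forms are skew, so testing the equations with the solution
    itself gives the a priori bounds, and testing the error equations with the
    error leaves only the difference of the convecting velocities as a source.
    That source is at most [lambda2 * (previous error) * (a priori bound)]; since
    [sigma = lambda2 * M / Cmin + lambda2 * M], where [M] is the a priori bound of
    the flow, one step contracts by [sigma], and the initial value plays the role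
    of an iterate with convecting velocity 0, whose error is at most [M].
    For coercivity the discrete current must be exactly divergence free, which
    follows from [div Y_h] being contained in [S_h].
    Every form is an L^2 inner product of two matrix fields, for instance
    [((u . nabla) v, w) = (nabla v, u^T w)] and [(K x B, v) = (K, B x v)], so
    bilinearity and bounds reduce to the Cauchy-Schwarz inequality once Hoelder's
    inequality puts [u^T w] and [B x v] in L^2. *)

(** * Extension by zero outside a set, and pointwise operations *)

Section restriction.
Context {R : realType} {T : Type}.
Implicit Types (f g : T -> R) (A : set T).

Lemma restrictE f A x : (f \_ A) x = if x \in A then f x else 0.
Proof. by rewrite patchE. Qed.

Lemma restrict_comp (phi : R -> R) f A : phi 0 = 0 ->
  (fun x => phi (f x)) \_ A = (fun x => phi ((f \_ A) x)).
Proof. by move=> phi0; apply/funext => x; rewrite !restrictE; case: ifP. Qed.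

Lemma restrict_mul f g A :
  (fun x => f x * g x) \_ A = (f \_ A) \* (g \_ A).
Proof.
by apply/funext => x; rewrite /= !restrictE; case: ifP => // _; rewrite mulr0.
Qed.

Lemma restrictD f g A : (f + g) \_ A = (f \_ A) + (g \_ A).
Proof.
by apply/funext => x; rewrite /= !(restrictE, fctE); case: ifP => // _; rewrite addr0.
Qed.

Lemma restrictN f A : (- f) \_ A = - (f \_ A).
Proof.
by apply/funext => x; rewrite /= !(restrictE, fctE); case: ifP => // _; rewrite oppr0.
Qed.

End restriction.

(** * Lebesgue spaces and integrals of scalar functions on the domain *)

Section Lp_spaces.
Context {R : realType} {d : nat} (Om : set 'rV[R]_d).
Local Notation E := 'rV[R]_d.
Local Notation mu := (@lebesgue_rV R d).
Implicit Types (f g : E -> R).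

Definition measurable_on f := measurable_fun [set: E] (f \_ Om).

Lemma LpP (p : R) f :
  Lp Om p f <-> measurable_on f /\ (Lp_enorm Om p f < +oo)%E.
Proof.
rewrite /Lp /= /Lp_enorm /measurable_on; split.
  by case/andP => /[!inE] m l; split.
by case=> m l; apply/andP; rewrite !inE.
Qed.

Lemma Lp_measurable p f : Lp Om p f -> measurable_on f.
Proof. by case/LpP. Qed.

Lemma LpD (p : R) f g : 1 <= p -> Lp Om p f -> Lp Om p g -> Lp Om p (f + g).
Proof.
move=> p1; rewrite /Lp /= restrictD => Hf Hg.
by rewrite -lee_fin in p1; have := @Lfun_addr_closed _ _ R mu p%:E p1; case => _; apply.
Qed.

Lemma LpN (p : R) f : 1 <= p -> Lp Om p f -> Lp Om p (- f).
Proof.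
move=> p1; rewrite /Lp /= restrictN => Hf.
by rewrite -lee_fin in p1; have := @Lfun_oppr_closed _ _ R mu p%:E; apply.
Qed.

Lemma LpB (p : R) f g : 1 <= p -> Lp Om p f -> Lp Om p g -> Lp Om p (f - g).
Proof. by move=> p1 Hf Hg; apply: LpD => //; exact: LpN. Qed.

Lemma LpZ (p a : R) f : 1 <= p -> Lp Om p f -> Lp Om p (fun x => a * f x).
Proof.
rewrite /Lp /= => p1 Hf.
have -> : (fun x => a * f x) \_ Om = a \o* (f \_ Om).
  by apply/funext => x; rewrite /= !restrictE mulrC; case: ifP => // _; rewrite mul0r.
exact: Lfun_scale.
Qed.

Lemma Lp0 (p : R) : 1 <= p -> Lp Om p 0.
Proof.
move=> p1; rewrite /Lp /= (_ : _ \_ _ = 0).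
  by rewrite -lee_fin in p1; have := @Lfun_addr_closed _ _ R mu p%:E p1; case.
by apply/funext => x; rewrite restrictE; case: ifP.
Qed.

Lemma Lp_sum (p : R) (I : Type) (s : seq I) (F : I -> E -> R) : 1 <= p ->
  (forall i, Lp Om p (F i)) -> Lp Om p (\sum_(i <- s) F i).
Proof.
move=> p1 HF; elim: s => [|i s IH]; first by rewrite big_nil; exact: Lp0.
by rewrite big_cons; exact: LpD.
Qed.

Lemma Lp_mul f g : Lp Om 2 f -> Lp Om 2 g -> Lp Om 1 (fun x => f x * g x).
Proof.
by rewrite /Lp /= restrict_mul => Hf Hg; exact: Lfun2_mul_Lfun1.
Qed.

Lemma measurable_onM f g : measurable_on f -> measurable_on g ->
  measurable_on (fun x => f x * g x).
Proof. by rewrite /measurable_on restrict_mul => mf mg; exact: measurable_funM. Qed.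

Lemma Lp_enorm_le (p : R) f g : 0 <= p ->
  measurable_on f -> measurable_on g -> (forall x, `|f x| <= `|g x|) ->
  (Lp_enorm Om p f <= Lp_enorm Om p g)%E.
Proof.
move=> p0 mf mg fg; rewrite /Lp_enorm unlock /Lnorm.
have I0 (h : E -> R) : ((\int[mu]_x `|(EFin \o h) x| `^ p) \in `[0, +oo])%E.
  by rewrite in_itv /= leey andbT integral_ge0 // => x _; exact: poweR_ge0.
have mp (h : E -> R) : measurable_fun setT h ->
    measurable_fun setT (fun x => (`|(EFin \o h) x| `^ p)%E).
  move=> mh; apply: (measurableT_comp (measurable_poweR _)).
  by do 2 apply: measurableT_comp => //.
apply: gt0_ler_poweR; rewrite ?invr_ge0 //; apply: ge0_le_integral => //.
- by move=> x _; exact: poweR_ge0.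
- exact: mp.
- exact: mp.
- move=> x _; apply: gt0_ler_poweR => //; rewrite ?in_itv /= ?leey ?andbT //.
  by rewrite lee_fin !restrictE; case: ifP.
Qed.

Lemma Lp_le (p : R) f g : 0 <= p -> measurable_on f ->
  (forall x, `|f x| <= `|g x|) -> Lp Om p g -> Lp Om p f.
Proof.
move=> p0 mf fg /LpP[mg gf]; apply/LpP; split => //.
exact: le_lt_trans (Lp_enorm_le p0 mf mg fg) gf.
Qed.

Lemma Lp_norm_ge0 p f : 0 <= Lp_norm Om p f.
Proof. by rewrite /Lp_norm fine_ge0 //; exact: Lnorm_ge0. Qed.

Lemma norm0_sqr f : Lp Om 2 f -> norm0 Om f ^+ 2 = ip Om f f.
Proof.
move=> Lf; rewrite /norm0 /ip -powR_mulrn ?Lp_norm_ge0 //.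
rewrite -fine_poweR poweR_Lnorm ?pnatr_eq0 // Rintegral_mkcond /Rintegral.
congr fine; apply: eq_integral => x _.
by rewrite restrict_mul /= powR_mulrn // real_normK // num_real.
Qed.

Lemma Lp_normE (p : R) f : Lp Om p f ->
  (Lp_norm Om p f)%:E = Lp_enorm Om p f.
Proof.
move=> /LpP[_ h]; rewrite /Lp_norm fineK // ge0_fin_numE //.
exact: Lnorm_ge0.
Qed.

Lemma Rintegral_OmB f g : Lp Om 1 f -> Lp Om 1 g ->
  \int[mu]_(x in Om) (f x - g x)  =
  \int[mu]_(x in Om) f x - \int[mu]_(x in Om) g x.
Proof.
rewrite /Lp /= => /Lfun1_integrable If /Lfun1_integrable Ig.
rewrite !(Rintegral_mkcond _ Om) -RintegralB //.
by apply: eq_Rintegral => x _; rewrite !restrictE; case: ifP => // _; rewrite subr0.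
Qed.

Lemma Rintegral_OmZ a f : Lp Om 1 f ->
  \int[mu]_(x in Om) (a * f x)  = a * \int[mu]_(x in Om) f x.
Proof.
rewrite /Lp /= => /Lfun1_integrable If.
rewrite !(Rintegral_mkcond _ Om) -RintegralZl //.
by apply: eq_Rintegral => x _; rewrite !restrictE; case: ifP => // _; rewrite mulr0.
Qed.

(** Needed because the divergence of a discrete current agrees with an element of [Sh] only almost
    everywhere. *)
Lemma Rintegral_Om_ae f g : measurable_on f -> measurable_on g ->
  {ae mu, forall x, Om x -> f x = g x} ->
  \int[mu]_(x in Om) f x = \int[mu]_(x in Om) g x.
Proof.
move=> mf mg fg; rewrite /Rintegral; congr fine.
rewrite [LHS]integral_mkcond [RHS]integral_mkcond.
apply: ae_eq_integral => //.
- by rewrite restrict_EFin; exact/measurable_EFinP.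
- by rewrite restrict_EFin; exact/measurable_EFinP.
- apply: filterS fg => x fg _; rewrite !restrict_EFin /= !restrictE.
  by case: ifPn => // /set_mem /fg ->.
Qed.

End Lp_spaces.

(** * Hoelder's inequality for a product measured in $L^r$ *)

Section hoelder_product.
Context dd (T : measurableType dd) (R : realType).
Variable mu : {measure set T -> \bar R}.

(** Raising $|f|$ to the power $r$ divides the exponent by $r$; this reduces an inequality in $L^r$
    to one in $L^1$. *)
Lemma Lnorm_powR (f : T -> R) (p r : R) : 0 < r -> 0 < p ->
  ('N[mu]_(p / r)%:E[EFin \o (fun x => `|f x| `^ r)%R] `^ r^-1 =
   'N[mu]_p%:E[EFin \o f])%E.
Proof.
move=> r0 p0; rewrite unlock /Lnorm -poweRrM invf_div mulrAC mulfV ?gt_eqF // mul1r.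
congr (_ `^ _)%E; apply: eq_integral => x _ /=.
by rewrite ger0_norm ?powR_ge0 // -powRrM mulrC mulfVK ?gt_eqF.
Qed.

(** The usual inequality is applied to $|f|^r$ and $|g|^r$ with the conjugate exponents $p/r$ and
    $q/r$; the root of order $r$ is monotone. *)
Lemma Lnorm_prod_le (f g : T -> R) (p q r : R) :
  measurable_fun setT f -> measurable_fun setT g ->
  0 < p -> 0 < q -> 0 < r -> p^-1 + q^-1 = r^-1 ->
  ('N[mu]_r%:E[EFin \o (fun x => f x * g x)%R] <=
   'N[mu]_p%:E[EFin \o f] * 'N[mu]_q%:E[EFin \o g])%E.
Proof.
move=> mf mg p0 q0 r0 pqr.
have mpow (h : T -> R) : measurable_fun setT h -> measurable_fun setT (fun x : T => (`|h x| `^ r)%R).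
  by move=> mh; apply: (measurableT_comp (measurable_powR _)); exact: measurableT_comp.
rewrite -(Lnorm_powR f r0 p0) -(Lnorm_powR g r0 q0).
rewrite -poweRM ?Lnorm_ge0 // -(Lnorm_powR _ r0 r0) divff ?gt_eqF //.
apply: gt0_ler_poweR; rewrite ?invr_ge0 ?(ltW r0) // ?in_itv /= ?leey ?mule_ge0 ?Lnorm_ge0 //.
have pr : (p / r)^-1 + (q / r)^-1 = 1.
  by rewrite !invf_div -mulrDr pqr mulfV ?gt_eqF.
have := hoelder mu (mpow _ mf) (mpow _ mg) (divr_gt0 p0 r0) (divr_gt0 q0 r0) pr.
rewrite (_ : 'N[mu]_1[_]%E = 'N[mu]_1[EFin \o (fun x => (`|f x * g x| `^ r)%R)]%E) //.
by apply: eq_Lnorm => x /=; rewrite normrM powRM.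
Qed.

End hoelder_product.

(** * Frobenius product and norm of matrices *)

Section matrix_dot.
Context {R : realType}.

Lemma sum_sqr_le_sqr_sum (I : Type) (s : seq I) (F : I -> R) :
  \sum_(i <- s) F i ^+ 2 <= (\sum_(i <- s) `|F i|) ^+ 2.
Proof.
elim: s => [|i s IH]; first by rewrite !big_nil expr0n.
rewrite !big_cons sqrrD real_normK ?num_real //.
rewrite -addrA lerD2l (le_trans IH) // lerDr mulrn_wge0 // mulr_ge0 // sumr_ge0 //.
Qed.

Context {m n : nat}.
Implicit Types A B C : 'M[R]_(m, n).

Lemma mxdotC A B : mxdot A B = mxdot B A.
Proof. by apply: eq_bigr => i _; apply: eq_bigr => j _; rewrite mulrC. Qed.

Lemma mxdotBl A B C : mxdot (A - B) C = mxdot A C - mxdot B C.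
Proof.
rewrite /mxdot -sumrB; apply: eq_bigr => i _; rewrite -sumrB.
by apply: eq_bigr => j _; rewrite !mxE mulrBl.
Qed.

Lemma mxdotZl (a : R) A B : mxdot (a *: A) B = a * mxdot A B.
Proof.
rewrite /mxdot mulr_sumr; apply: eq_bigr => i _; rewrite mulr_sumr.
by apply: eq_bigr => j _; rewrite !mxE mulrA.
Qed.

Lemma mxdot_ge0 A : 0 <= mxdot A A.
Proof. by do 2 apply: sumr_ge0 => ? _; rewrite -expr2 sqr_ge0. Qed.

Lemma mxnorm_ge0 A : 0 <= mxnorm A.
Proof. exact: sqrtr_ge0. Qed.

Lemma mxnorm_sqr A : mxnorm A ^+ 2 = mxdot A A.
Proof. by rewrite sqr_sqrtr // mxdot_ge0. Qed.

Lemma coef_le_mxnorm A i j : `|A i j| <= mxnorm A.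
Proof.
rewrite -sqrtr_sqr; apply: ler_wsqrtr; rewrite /mxdot (bigD1 i) //= (bigD1 j) //=.
rewrite -!expr2 -addrA lerDl addr_ge0 // sumr_ge0 // => k _.
  by rewrite -expr2 sqr_ge0.
by apply: sumr_ge0 => l _; rewrite -expr2 sqr_ge0.
Qed.

(** Comparison of the Euclidean and the sum norm, through which integrability of the entries passes
    to the norm. *)
Lemma mxnorm_le_sum A : mxnorm A <= \sum_i \sum_j `|A i j|.
Proof.
have s0 : 0 <= \sum_i \sum_j `|A i j| by do 2 apply: sumr_ge0 => ? _.
rewrite -[leRHS]ger0_norm // -sqrtr_sqr; apply: ler_wsqrtr.
rewrite /mxdot !pair_big /=.
rewrite (eq_bigr (fun p : 'I_m * 'I_n => A p.1 p.2 ^+ 2)) //.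
exact: sum_sqr_le_sqr_sum.
Qed.

End matrix_dot.

(** Discriminant argument, with the degenerate case [c = 0] treated apart. *)
Lemma quadratic_CauchySchwarz (R : realType) (a b c : R) : 0 <= a -> 0 <= c ->
  (forall t, 0 <= a - 2 * t * b + t ^+ 2 * c) -> `|b| <= Num.sqrt a * Num.sqrt c.
Proof.
move=> a0 c0 H; rewrite -sqrtrM // -sqrtr_sqr; apply: ler_wsqrtr.
have [c_eq0|c_neq0] := eqVneq c 0.
  have [->|b0] := eqVneq b 0; first by rewrite expr0n mulr_ge0.
  (* With [c = 0] the hypothesis is affine in [t], and this [t] brings its value down to -1. *)
  have := H ((a + 1) / (2 * b)); rewrite c_eq0 mulr0 addr0.
  have -> : 2 * ((a + 1) / (2 * b)) * b = a + 1 by field.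
  by lra.
(* The minimiser of the quadratic. *)
have := H (b / c).
have -> : a - 2 * (b / c) * b + (b / c) ^+ 2 * c = (a * c - b ^+ 2) / c by field.
by rewrite pmulr_lge0 ?subr_ge0 // invr_gt0 lt_def c_neq0.
Qed.

(** * Square integrable matrix fields and their inner product *)

Section Lp_matrix.
Context {R : realType} {d : nat} (Om : set 'rV[R]_d).
Local Notation E := 'rV[R]_d.
Local Notation mu := (@lebesgue_rV R d).

Definition measurable_on_mx m n (F : E -> 'M[R]_(m, n)) :=
  forall i j, measurable_on Om (fun x => F x i j).

Lemma measurable_on_comp (phi : R -> R) (f : E -> R) :
  measurable_fun setT phi -> phi 0 = 0 ->
  measurable_on Om f -> measurable_on Om (fun x => phi (f x)).
Proof.
move=> mphi phi0 mf; rewrite /measurable_on restrict_comp //.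
exact: (measurableT_comp mphi mf).
Qed.

Lemma measurable_on_sum (I : Type) (s : seq I) (F : I -> E -> R) :
  (forall i, measurable_on Om (F i)) ->
  measurable_on Om (fun x => \sum_(i <- s) F i x).
Proof.
move=> mF; rewrite /measurable_on.
rewrite (_ : _ \_ _ = fun x => \sum_(i <- s) (F i \_ Om) x).
  exact: measurable_sum.
apply/funext => x; rewrite restrictE; case: ifPn => xOm.
  by apply: eq_bigr => i _; rewrite restrictE xOm.
by rewrite big1 // => i _; rewrite restrictE (negbTE xOm).
Qed.

Lemma measurable_on_mxdot m n (F G : E -> 'M[R]_(m, n)) :
  measurable_on_mx F -> measurable_on_mx G ->
  measurable_on Om (fun x => mxdot (F x) (G x)).
Proof.
by move=> mF mG; do 2 apply: measurable_on_sum => ?; exact: measurable_onM.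
Qed.

Lemma measurable_on_mxnorm m n (F : E -> 'M[R]_(m, n)) :
  measurable_on_mx F -> measurable_on Om (fun x => mxnorm (F x)).
Proof.
move=> mF; apply: (measurable_on_comp _ (sqrtr0 R)).
  by apply: continuous_measurable_fun; exact: sqrt_continuous.
exact: measurable_on_mxdot.
Qed.

Lemma Lp_norm_fun (p : R) (f : E -> R) : 0 <= p -> Lp Om p f ->
  Lp Om p (fun x => `|f x|).
Proof.
move=> p0 Lf; apply: (Lp_le p0 _ _ Lf) => [|x]; last by rewrite normr_id.
apply: measurable_on_comp (Lp_measurable Lf); last exact: normr0.
exact: normr_measurable.
Qed.

Lemma Lp_sum_fun (p : R) (I : Type) (s : seq I) (F : I -> E -> R) : 1 <= p ->
  (forall i, Lp Om p (F i)) -> Lp Om p (fun x => \sum_(i <- s) F i x).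
Proof.
move=> p1 HF; have := Lp_sum s p1 HF; congr (Lp _ _ _).
by apply/funext => x; rewrite fct_sumE.
Qed.

Variables (m n : nat).
Implicit Types F G H : E -> 'M[R]_(m, n).

Lemma Lp_mx_measurable p F : Lp_mx Om p F -> measurable_on_mx F.
Proof. by move=> LF i j; exact: Lp_measurable (LF i j). Qed.

Lemma Lp_mxB p F G : 1 <= p -> Lp_mx Om p F -> Lp_mx Om p G ->
  Lp_mx Om p (F - G).
Proof.
move=> p1 LF LG i j; have := LpB p1 (LF i j) (LG i j); congr (Lp _ _ _).
by apply/funext => x; rewrite !fctE !mxE.
Qed.

Lemma Lp_mxnorm (p : R) F : 1 <= p -> Lp_mx Om p F ->
  Lp Om p (fun x => mxnorm (F x)).
Proof.
move=> p1 LF; have p0 : 0 <= p by exact: le_trans p1.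
apply: (Lp_le p0 (g := fun x => \sum_i \sum_j `|F x i j|)).
- by apply: measurable_on_mxnorm; exact: Lp_mx_measurable LF.
- move=> x; rewrite ger0_norm ?mxnorm_ge0 // (le_trans (mxnorm_le_sum _)) //.
  exact: ler_norm.
- by do 2 apply: Lp_sum_fun => // ?; exact: Lp_norm_fun.
Qed.

Lemma Lp_mxdot F G : Lp_mx Om 2 F -> Lp_mx Om 2 G ->
  Lp Om 1 (fun x => mxdot (F x) (G x)).
Proof.
by move=> LF LG; do 2 apply: Lp_sum_fun => // ?; exact: Lp_mul.
Qed.

Lemma ip_mxC F G : ip_mx Om F G = ip_mx Om G F.
Proof. by apply: eq_Rintegral => x _; exact: mxdotC. Qed.

Lemma ip_mxBl F G H : Lp_mx Om 2 F -> Lp_mx Om 2 G -> Lp_mx Om 2 H ->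
  ip_mx Om (F - G) H = ip_mx Om F H - ip_mx Om G H.
Proof.
move=> LF LG LH; rewrite /ip_mx -Rintegral_OmB; [|exact: Lp_mxdot..].
by apply: eq_Rintegral => x _; rewrite !fctE mxdotBl.
Qed.

Lemma ip_mxBr F G H : Lp_mx Om 2 F -> Lp_mx Om 2 G -> Lp_mx Om 2 H ->
  ip_mx Om H (F - G) = ip_mx Om H F - ip_mx Om H G.
Proof. by move=> LF LG LH; rewrite !(ip_mxC H) ip_mxBl. Qed.

Lemma Lp_mxZ (a : R) F : Lp_mx Om 2 F -> Lp_mx Om 2 (fun x => a *: F x).
Proof.
have p1 : 1 <= 2 :> R by rewrite ler1n.
move=> LF i j; have := LpZ a p1 (LF i j); congr (Lp _ _ _).
by apply/funext => x; rewrite mxE.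
Qed.

Lemma ip_mxZl a F G : Lp_mx Om 2 F -> Lp_mx Om 2 G ->
  ip_mx Om (fun x => a *: F x) G = a * ip_mx Om F G.
Proof.
move=> LF LG; rewrite /ip_mx -Rintegral_OmZ; last exact: Lp_mxdot.
by apply: eq_Rintegral => x _; rewrite mxdotZl.
Qed.

Lemma norm0_mx_ge0 F : 0 <= norm0_mx Om F.
Proof. exact: Lp_norm_ge0. Qed.

Lemma norm0_mx_sqr F : Lp_mx Om 2 F -> norm0_mx Om F ^+ 2 = ip_mx Om F F.
Proof.
move=> LF; rewrite norm0_sqr; last by apply: Lp_mxnorm; rewrite // ler1n.
by apply: eq_Rintegral => x _; rewrite -expr2 mxnorm_sqr.
Qed.

Lemma ip_mx_ge0 F : 0 <= ip_mx Om F F.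
Proof. by apply: Rintegral_ge0 => x _; exact: mxdot_ge0. Qed.

(** The quadratic in [t] is the inner product of [F - t G] with itself. *)
Lemma ip_mx_CauchySchwarz F G : Lp_mx Om 2 F -> Lp_mx Om 2 G ->
  `|ip_mx Om F G| <= norm0_mx Om F * norm0_mx Om G.
Proof.
move=> LF LG.
have normE H : Lp_mx Om 2 H -> norm0_mx Om H = Num.sqrt (ip_mx Om H H).
  by move=> LH; rewrite -norm0_mx_sqr // sqrtr_sqr ger0_norm // norm0_mx_ge0.
rewrite !normE //.
apply: quadratic_CauchySchwarz => [||t]; [exact: ip_mx_ge0..|].
have LtG : Lp_mx Om 2 (fun x => t *: G x) by exact: Lp_mxZ.
have := ip_mx_ge0 (F - (fun x => t *: G x)).
have LFG : Lp_mx Om 2 (F - (fun x => t *: G x)) by apply: Lp_mxB; rewrite ?ler1n.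
rewrite ip_mxBl // !ip_mxBr // (ip_mxC F (fun x => t *: G x)) !ip_mxZl //.
rewrite (ip_mxC G (fun x => t *: G x)) !ip_mxZl // (ip_mxC G F).
by congr (0 <= _); ring.
Qed.

(** Common frame for the product fields below, with exponents 4 and 4 or 3 and 6. Bounds on the
    extended norms make square integrability part of the conclusion. *)
Lemma norm0_mx_prod_le F (f g : E -> R) (p q a b : R) :
  0 < p -> 0 < q -> p^-1 + q^-1 = 2^-1 -> measurable_on_mx F ->
  measurable_on Om f -> measurable_on Om g ->
  (forall x, mxnorm (F x) <= `|f x * g x|) ->
  (Lp_enorm Om p f <= a%:E)%E -> (Lp_enorm Om q g <= b%:E)%E ->
  Lp_mx Om 2 F /\ norm0_mx Om F <= a * b.
Proof.
move=> p0 q0 pq mF mf mg Ffg fa gb.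
have N : (Lp_enorm Om 2 (fun x => mxnorm (F x)) <= (a * b)%:E)%E.
  apply: (@le_trans _ _ (Lp_enorm Om p f * Lp_enorm Om q g)%E); last first.
    by rewrite EFinM; apply: lee_pmul => //; exact: Lnorm_ge0.
  apply: (@le_trans _ _ (Lp_enorm Om 2 (fun x => f x * g x))).
    apply: Lp_enorm_le => //; first exact: measurable_on_mxnorm.
      exact: measurable_onM.
    by move=> x; rewrite ger0_norm ?mxnorm_ge0.
  by rewrite /Lp_enorm restrict_mul; exact: Lnorm_prod_le.
have L : Lp Om 2 (fun x => mxnorm (F x)).
  apply/LpP; split; first exact: measurable_on_mxnorm.
  exact: le_lt_trans N (ltry _).
split; last by rewrite -lee_fin Lp_normE.
move=> i j; apply: Lp_le L => // x.
by rewrite [leRHS]ger0_norm ?mxnorm_ge0 // coef_le_mxnorm.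
Qed.

End Lp_matrix.

(** Two shapes are allowed so that a field can be compared with its padding to three components. *)
Lemma norm0_mx_le (R : realType) (d : nat) (Om : set 'rV[R]_d) m n p q
    (F : 'rV[R]_d -> 'M[R]_(m, n)) (G : 'rV[R]_d -> 'M[R]_(p, q)) :
  measurable_on_mx Om F ->
  Lp_mx Om 2 G -> (forall x, mxnorm (F x) <= mxnorm (G x)) ->
  Lp_mx Om 2 F /\ norm0_mx Om F <= norm0_mx Om G.
Proof.
move=> mF LG FG.
have LG2 : Lp Om 2 (fun x => mxnorm (G x)) by apply: Lp_mxnorm; rewrite ?ler1n.
have mF2 : measurable_on Om (fun x => mxnorm (F x)) by exact: measurable_on_mxnorm.
have FG' x : `|mxnorm (F x)| <= `|mxnorm (G x)| by rewrite !ger0_norm ?mxnorm_ge0.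
have LF2 : Lp Om 2 (fun x => mxnorm (F x)) by exact: Lp_le FG' LG2.
split.
  move=> i j; apply: Lp_le LF2 => // x.
  by rewrite [leRHS]ger0_norm ?mxnorm_ge0 // coef_le_mxnorm.
rewrite -lee_fin !Lp_normE //; apply: Lp_enorm_le => //.
exact: Lp_measurable LG2.
Qed.

(** * Pointwise algebra of outer, scalar and cross products *)

Section pointwise_products.
Context {R : realType}.

(** Both sides are $\sum_{i,j}u_iG_{ij}w_j$. The gradient becomes one factor of an $L^2$ product. *)
Lemma mxdot_mulmx m n (u : 'rV[R]_m) (G : 'M[R]_(m, n)) (w : 'rV[R]_n) :
  mxdot (u *m G) w = mxdot G (u^T *m w).
Proof.
rewrite /mxdot big_ord1 exchange_big; apply: eq_bigr => j _ /=.
rewrite mxE mulr_suml; apply: eq_bigr => i _.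
by rewrite mxE big_ord1 !mxE mulrCA mulrA.
Qed.

Lemma mxnorm_outer m n (u : 'rV[R]_m) (w : 'rV[R]_n) :
  mxnorm (u^T *m w) = mxnorm u * mxnorm w.
Proof.
rewrite /mxnorm -sqrtrM ?mxdot_ge0 //; congr Num.sqrt.
rewrite /mxdot !big_ord1 mulr_suml; apply: eq_bigr => i _.
rewrite mulr_sumr; apply: eq_bigr => j _.
by rewrite !mxE big_ord1 !mxE; ring.
Qed.

Lemma mxnormZ m n (a : R) (A : 'M[R]_(m, n)) : mxnorm (a *: A) = `|a| * mxnorm A.
Proof.
rewrite -sqrtr_sqr /mxnorm -sqrtrM ?sqr_ge0 //; congr Num.sqrt.
by rewrite mxdotZl mxdotC mxdotZl mulrA.
Qed.

Lemma sum_I3 (f : 'I_3 -> R) : \sum_i f i = f 0 + f 1 + f 2.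
Proof.
rewrite !big_ord_recl big_ord0 addr0 addrA.
by congr (f _ + f _ + f _); apply/val_inj.
Qed.

Lemma mxdot3 (a b : 'rV[R]_3) :
  mxdot a b = a 0 0 * b 0 0 + a 0 1 * b 0 1 + a 0 2 * b 0 2.
Proof. by rewrite /mxdot big_ord1 sum_I3. Qed.

(** Index table modulo 3; after rewriting with it, components of cross products are polynomials that
    [ring] can compare. *)
Lemma I3_add :
  ((0 + 1 = 1 :> 'I_3)%R * (0 + 2 = 2 :> 'I_3)%R * (1 + 1 = 2 :> 'I_3)%R * (1 + 2 = 0 :> 'I_3)%R * (2 + 1 = 0 :> 'I_3)%R * (2 + 2 = 1 :> 'I_3)%R)%type.
Proof. by do !split; apply/val_inj. Qed.

(** Cyclic invariance of the scalar triple product; it moves the magnetic field onto the velocity,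
    where $L^3$ meets $L^6$. *)
Lemma mxdot_cross (a b c : 'rV[R]_3) : mxdot (cross a b) c = mxdot a (cross b c).
Proof. by rewrite !mxdot3 !mxE !I3_add; ring. Qed.

(** Lagrange's identity: $|a|^2|b|^2-|a\times b|^2=(a\cdot b)^2$. *)
Lemma mxnorm_cross (a b : 'rV[R]_3) : mxnorm (cross a b) <= mxnorm a * mxnorm b.
Proof.
rewrite /mxnorm -sqrtrM ?mxdot_ge0 //; apply: ler_wsqrtr.
rewrite -subr_ge0 (_ : _ - _ = mxdot a b ^+ 2) ?sqr_ge0 //.
by rewrite !mxdot3 !mxE !I3_add; ring.
Qed.

Lemma crossBr (a b c : 'rV[R]_3) : cross a (b - c) = cross a b - cross a c.
Proof. by apply/rowP => k; rewrite !mxE; ring. Qed.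

Lemma pad3B d (u v : 'rV[R]_d) : pad3 (u - v) = pad3 u - pad3 v.
Proof.
apply/rowP => k; rewrite !mxE; case: insubP => [j _ _|_]; rewrite ?mxE //.
by rewrite subr0.
Qed.

Lemma mxnorm_pad3 d (v : 'rV[R]_d) : mxnorm (pad3 v) <= mxnorm v.
Proof.
apply: ler_wsqrtr; rewrite /mxdot !big_ord1.
(* One sequence on all of [nat], zero from [d] on, carries both sums; they are then compared inside
   a sum of length $3+d$. *)
pose F (k : nat) : R := if insub k is Some j then v 0 (j : 'I_d) ^+ 2 else 0.
have F0 k : 0 <= F k by rewrite /F; case: insub => // j; exact: sqr_ge0.
have -> : \sum_j pad3 v 0 j * pad3 v 0 j = \sum_(k < 3) F k.
  apply: eq_bigr => k _; rewrite !mxE /F; case: insub => [j|]; last by rewrite mulr0.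
  by rewrite expr2.
have -> : \sum_j v 0 j * v 0 j = \sum_(k < d) F k.
  by apply: eq_bigr => k _; rewrite /F valK expr2.
rewrite (big_ord_widen _ F (leq_addr d 3)) (big_ord_widen _ F (leq_addl 3 d)).
rewrite [leRHS]big_mkcond [leLHS]big_mkcond; apply: ler_sum => k _.
case: ifPn => _; case: ifPn => // kd; rewrite /F insubF //; exact: negbTE.
Qed.

End pointwise_products.

(** * Hoelder bounds for products of velocity, temperature and magnetic field *)

Section form_estimates.
Context {R : realType} {d : nat} (D : problem_data R d).
Context (hD : well_posed_data D) (COm lambda1 lambda2 : R).
Context (hemb : embedding_constants D COm lambda1 lambda2).
Local Notation Om := (Omega D).
Local Notation E := 'rV[R]_d.
Local Notation X := (H10_vec Om).
Local Notation Z := (H10 Om).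
Local Notation B3 := (Lp_norm Om 3 (fun x => mxnorm (Bfield D x))).

Lemma H10_vec_Lp (v : h1_vector R d) : X v -> Lp_mx Om 2 v.1 /\ Lp_mx Om 2 v.2.
Proof.
move=> Xv; split=> i j; have [[/= v1 v2 _] _] := Xv j; first by rewrite ord1.
have := v2 0 i; congr (Lp _ _ _).
by apply/funext => x; rewrite !mxE.
Qed.

Lemma H10_Lp (r : h1_scalar R d) : Z r -> Lp Om 2 r.1 /\ Lp_mx Om 2 r.2.
Proof. by case=> -[]. Qed.

Lemma X_norm_ge0 (v : h1_vector R d) : 0 <= X_norm D v.
Proof. exact: norm0_mx_ge0. Qed.

Lemma Z_norm_ge0 (r : h1_scalar R d) : 0 <= Z_norm D r.
Proof. exact: norm0_mx_ge0. Qed.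

(** Brings the $L^4$ embedding, assumed for the square of the norm, to first order; the finite
    right-hand side excludes an infinite [x]. *)
Lemma sqr_ereal_le (x : \bar R) (l a : R) : (0 <= x)%E -> 0 <= a -> 0 <= l ->
  (x ^+ 2 <= (l * a ^+ 2)%:E)%E -> (x <= (Num.sqrt l * a)%:E)%E.
Proof.
case: x => [x| |] //.
rewrite expe2 -EFinM !lee_fin => x0 a0 l0 h.
rewrite -(ger0_norm x0) -(ger0_norm a0) -!sqrtr_sqr -sqrtrM //.
by apply: ler_wsqrtr; rewrite expr2.
Qed.

Lemma L4_vector v : X v ->
  (Lp_enorm Om 4 (fun x => mxnorm (v.1 x)) <= (Num.sqrt lambda2 * X_norm D v)%:E)%E.
Proof.
case: hemb => _ _ l0 hv _ /hv[_ _]; apply: sqr_ereal_le; rewrite ?X_norm_ge0 ?(ltW l0) //.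
exact: Lnorm_ge0.
Qed.

Lemma L4_scalar r : Z r ->
  (Lp_enorm Om 4 r.1 <= (Num.sqrt lambda2 * Z_norm D r)%:E)%E.
Proof.
case: hemb => _ _ l0 _ hr /hr[_ _]; apply: sqr_ereal_le; rewrite ?Z_norm_ge0 ?(ltW l0) //.
exact: Lnorm_ge0.
Qed.

Definition outer (u w : h1_vector R d) : E -> 'M[R]_d :=
  fun x => (u.1 x)^T *m w.1 x.

Definition scaled (r : h1_scalar R d) (u : h1_vector R d) : E -> E :=
  fun x => r.1 x *: u.1 x.

Definition Bcross (v : h1_vector R d) : E -> 'rV[R]_3 :=
  fun x => cross (Bfield D x) (pad3 (v.1 x)).

Definition padded (F : E -> E) : E -> 'rV[R]_3 := fun x => pad3 (F x).

Lemma lambda2_sqr (a b : R) :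
  (Num.sqrt lambda2 * a) * (Num.sqrt lambda2 * b) = lambda2 * a * b.
Proof.
case: hemb => _ _ l0 _ _.
by rewrite mulrACA -expr2 sqr_sqrtr ?(ltW l0) // mulrA.
Qed.

Lemma quarter2 : 4^-1 + 4^-1 = 2^-1 :> R. Proof. lra. Qed.

Lemma third_sixth : 3^-1 + 6^-1 = 2^-1 :> R. Proof. lra. Qed.

Lemma measurable_on_mxM m n p (F : E -> 'M[R]_(m, n)) (G : E -> 'M[R]_(n, p)) :
  measurable_on_mx Om F -> measurable_on_mx Om G ->
  measurable_on_mx Om (fun x => F x *m G x).
Proof.
move=> mF mG i j; under eq_fun do rewrite mxE.
by apply: measurable_on_sum => k; exact: measurable_onM.
Qed.

(** Exponents 4 and 4; the two factors $\sqrt{\lambda_2}$ multiply to [lambda2]. *)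
Lemma outer_bound u w : X u -> X w ->
  Lp_mx Om 2 (outer u w) /\
  norm0_mx Om (outer u w) <= lambda2 * X_norm D u * X_norm D w.
Proof.
move=> Xu Xw; rewrite -lambda2_sqr.
have [/Lp_mx_measurable mu _] := H10_vec_Lp Xu.
have [/Lp_mx_measurable mw _] := H10_vec_Lp Xw.
apply: norm0_mx_prod_le quarter2 _ _ _ _ (L4_vector Xu) (L4_vector Xw) => //.
- apply: measurable_on_mxM => // i j; under eq_fun do rewrite mxE; exact: mu.
- exact: measurable_on_mxnorm.
- exact: measurable_on_mxnorm.
- by move=> x; rewrite mxnorm_outer ler_norm.
Qed.

Lemma scaled_bound r u : Z r -> X u ->
  Lp_mx Om 2 (scaled r u) /\
  norm0_mx Om (scaled r u) <= lambda2 * Z_norm D r * X_norm D u.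
Proof.
move=> Zr Xu; rewrite -lambda2_sqr.
have [/Lp_mx_measurable mu _] := H10_vec_Lp Xu.
have [/Lp_measurable mr _] := H10_Lp Zr.
apply: norm0_mx_prod_le quarter2 _ _ _ _ (L4_scalar Zr) (L4_vector Xu) => //.
- by move=> i j; under eq_fun do rewrite mxE; exact: measurable_onM.
- exact: measurable_on_mxnorm.
- by move=> x; rewrite mxnormZ normrM [X in _ <= _ * X]ger0_norm ?mxnorm_ge0.
Qed.

Lemma measurable_padded F : measurable_on_mx Om F -> measurable_on_mx Om (padded F).
Proof.
move=> mF i j; rewrite /padded.
under eq_fun do rewrite mxE.
case: insubP => [k _ _|_]; first exact: mF.
rewrite /measurable_on (_ : patch _ _ _ = cst 0); first exact: measurable_cst.
by apply/funext => x; rewrite restrictE; case: ifP.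
Qed.

Lemma padded_bound F : Lp_mx Om 2 F ->
  Lp_mx Om 2 (padded F) /\ norm0_mx Om (padded F) <= norm0_mx Om F.
Proof.
move=> LF; apply: norm0_mx_le => //; last by move=> x; exact: mxnorm_pad3.
by apply: measurable_padded; exact: Lp_mx_measurable LF.
Qed.

(** Exponents 3 and 6. Multiplied by [kappa], the constant becomes the last entry of the maximum in
    [Cmax]. *)
Lemma Bcross_bound v : X v ->
  Lp_mx Om 2 (Bcross v) /\
  norm0_mx Om (Bcross v) <= B3 * (lambda1 * X_norm D v).
Proof.
move=> Xv; case: hemb => _ _ _ /(_ v Xv)[_ v6 _] _; case: hD => _ _ [LB _] _ _.
have [/Lp_mx_measurable mv _] := H10_vec_Lp Xv.
have LB3 : Lp Om 3 (fun x => mxnorm (Bfield D x)) by apply: Lp_mxnorm; rewrite ?ler1n.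
have B3E : (Lp_enorm Om 3 (fun x => mxnorm (Bfield D x)) <= B3%:E)%E by rewrite Lp_normE.
apply: norm0_mx_prod_le third_sixth _ _ _ _ B3E v6 => //.
- have mp := measurable_padded mv; have mB := Lp_mx_measurable LB.
  move=> i j.
  (* Each component of the cross product is a difference of two products; [k] and [l] are index
     shifts modulo 3. *)
  pose f k l x := Bfield D x 0 (j + k) * padded v.1 x 0 (j + l).
  have mf k l : measurable_on Om (f k l) by exact: measurable_onM.
  have -> : (fun x => cross (Bfield D x) (pad3 (v.1 x)) i j) = f 1 2 - f 2 1.
    by apply/funext => x; rewrite mxE.
  rewrite /measurable_on restrictD restrictN.
  by apply: measurable_funD; [exact: mf|apply: measurable_funN; exact: mf].
- exact: Lp_measurable LB3.
- exact: measurable_on_mxnorm.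
- move=> x; rewrite (le_trans (mxnorm_cross _ _)) // ger0_norm ?mulr_ge0 ?mxnorm_ge0 //.
  by rewrite ler_wpM2l ?mxnorm_ge0 // mxnorm_pad3.
Qed.

End form_estimates.

(** * Bilinearity and boundedness of the forms *)

Section form_linearity.
Context {R : realType} {d : nat} (D : problem_data R d).
Context (hD : well_posed_data D) (COm lambda1 lambda2 : R).
Context (hemb : embedding_constants D COm lambda1 lambda2).
Local Notation Om := (Omega D).
Local Notation E := 'rV[R]_d.
Local Notation X := (H10_vec Om).
Local Notation Z := (H10 Om).
Local Notation B3 := (Lp_norm Om 3 (fun x => mxnorm (Bfield D x))).
Local Notation outer_bound := (outer_bound hemb).
Local Notation scaled_bound := (scaled_bound hemb).
Local Notation Bcross_bound := (Bcross_bound hD hemb).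

Implicit Types (u v w : h1_vector R d) (r theta : h1_scalar R d).
Implicit Types (J K : hdiv_vector R d) (eta Phi : flow_pair R d) (chi : pressure_pair R d).

Lemma c_formE u v w : c_form D u v w =
  2^-1 * ip_mx Om v.2 (outer u w) - 2^-1 * ip_mx Om w.2 (outer u v).
Proof.
by rewrite /c_form; congr (_ * _ - _ * _); apply: eq_Rintegral => x _; rewrite mxdot_mulmx.
Qed.

Lemma h_formE u theta r : h_form D u theta r =
  2^-1 * ip_mx Om theta.2 (scaled r u) - 2^-1 * ip_mx Om r.2 (scaled theta u).
Proof.
rewrite /h_form; congr (_ * _ - _ * _); apply: eq_Rintegral => x _;
by rewrite [RHS]mxdotC mxdotZl mulrC.
Qed.

Lemma d_formE K v : d_form D K v = - kappa D * ip_mx Om (padded K.1) (Bcross D v).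
Proof. by congr (_ * _); apply: eq_Rintegral => x _; rewrite mxdot_cross. Qed.

Lemma outerBl u u' w : outer (u - u') w = outer u w - outer u' w.
Proof. by apply/funext => x; rewrite !fctE /outer /= raddfB mulmxBl. Qed.

Lemma outerBr u w w' : outer u (w - w') = outer u w - outer u w'.
Proof. by apply/funext => x; rewrite !fctE /outer /= mulmxBr. Qed.

Lemma scaledBl (r r' : h1_scalar R d) u : scaled (r - r') u = scaled r u - scaled r' u.
Proof. by apply/funext => x; rewrite !fctE /scaled /= scalerBl. Qed.

Lemma scaledBr (r : h1_scalar R d) u u' : scaled r (u - u') = scaled r u - scaled r u'.
Proof. by apply/funext => x; rewrite !fctE /scaled /= scalerBr. Qed.

Lemma paddedB (F G : E -> E) : padded (F - G) = padded F - padded G.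
Proof. by apply/funext => x; rewrite !fctE /padded pad3B. Qed.

Lemma BcrossB v v' : Bcross D (v - v') = Bcross D v - Bcross D v'.
Proof. by apply/funext => x; rewrite !fctE /Bcross /= pad3B crossBr. Qed.

Lemma c_formBl u u' v w : X u -> X u' -> X v -> X w ->
  c_form D (u - u') v w = c_form D u v w - c_form D u' v w.
Proof.
move=> Xu Xu' Xv Xw; rewrite !c_formE !outerBl.
have [_ Lv] := H10_vec_Lp Xv; have [_ Lw] := H10_vec_Lp Xw.
have [Luw _] := outer_bound Xu Xw; have [Luw' _] := outer_bound Xu' Xw.
have [Luv _] := outer_bound Xu Xv; have [Luv' _] := outer_bound Xu' Xv.
by rewrite !ip_mxBr //; ring.
Qed.

Lemma c_formBm u v v' w : X u -> X v -> X v' -> X w ->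
  c_form D u (v - v') w = c_form D u v w - c_form D u v' w.
Proof.
move=> Xu Xv Xv' Xw; rewrite !c_formE !outerBr.
have [_ Lv] := H10_vec_Lp Xv; have [_ Lw] := H10_vec_Lp Xw.
have [_ Lv'] := H10_vec_Lp Xv'; have [Luw _] := outer_bound Xu Xw.
have [Luv _] := outer_bound Xu Xv; have [Luv' _] := outer_bound Xu Xv'.
by rewrite ip_mxBl // ip_mxBr //; ring.
Qed.

Lemma c_form_self u v : c_form D u v v = 0.
Proof. by rewrite /c_form subrr. Qed.

(** Both halves obey the same bound, so the factor 1/2 is compensated and the constant is exactly
    [lambda2]. *)
Lemma c_form_bound u v w : X u -> X v -> X w ->
  `|c_form D u v w| <= lambda2 * X_norm D u * X_norm D v * X_norm D w.
Proof.
move=> Xu Xv Xw; rewrite c_formE -mulrBr normrM ger0_norm ?invr_ge0 //.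
have [_ Lv] := H10_vec_Lp Xv; have [_ Lw] := H10_vec_Lp Xw.
have [Luw buw] := outer_bound Xu Xw; have [Luv buv] := outer_bound Xu Xv.
have H1 : `|ip_mx Om v.2 (outer u w)| <= X_norm D v * (lambda2 * X_norm D u * X_norm D w).
  by apply: le_trans (ip_mx_CauchySchwarz _ _) _ => //; apply: ler_wpM2l => //; exact: norm0_mx_ge0.
have H2 : `|ip_mx Om w.2 (outer u v)| <= X_norm D w * (lambda2 * X_norm D u * X_norm D v).
  by apply: le_trans (ip_mx_CauchySchwarz _ _) _ => //; apply: ler_wpM2l => //; exact: norm0_mx_ge0.
rewrite mulrC ler_pdivrMr //; apply: (le_trans (ler_normB _ _)).
by apply: (le_trans (lerD H1 H2)); lra.
Qed.

Lemma h_formBl u u' theta r : X u -> X u' -> Z theta -> Z r ->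
  h_form D (u - u') theta r = h_form D u theta r - h_form D u' theta r.
Proof.
move=> Xu Xu' Zt Zr; rewrite !h_formE !scaledBr.
have [_ Lt] := H10_Lp Zt; have [_ Lr] := H10_Lp Zr.
have [L1 _] := scaled_bound Zr Xu; have [L2 _] := scaled_bound Zr Xu'.
have [L3 _] := scaled_bound Zt Xu; have [L4 _] := scaled_bound Zt Xu'.
by rewrite !ip_mxBr //; ring.
Qed.

Lemma h_formBm u theta theta' r : X u -> Z theta -> Z theta' -> Z r ->
  h_form D u (theta - theta') r = h_form D u theta r - h_form D u theta' r.
Proof.
move=> Xu Zt Zt' Zr; rewrite !h_formE !scaledBl.
have [_ Lt] := H10_Lp Zt; have [_ Lr] := H10_Lp Zr; have [_ Lt'] := H10_Lp Zt'.
have [L1 _] := scaled_bound Zr Xu.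
have [L3 _] := scaled_bound Zt Xu; have [L4 _] := scaled_bound Zt' Xu.
by rewrite ip_mxBl // ip_mxBr //; ring.
Qed.

Lemma h_form_self u r : h_form D u r r = 0.
Proof. by rewrite /h_form subrr. Qed.

Lemma h_form_bound u theta r : X u -> Z theta -> Z r ->
  `|h_form D u theta r| <= lambda2 * X_norm D u * Z_norm D theta * Z_norm D r.
Proof.
move=> Xu Zt Zr; rewrite h_formE -mulrBr normrM ger0_norm ?invr_ge0 //.
have [_ Lt] := H10_Lp Zt; have [_ Lr] := H10_Lp Zr.
have [Lru bru] := scaled_bound Zr Xu; have [Ltu btu] := scaled_bound Zt Xu.
have H1 : `|ip_mx Om theta.2 (scaled r u)| <= Z_norm D theta * (lambda2 * Z_norm D r * X_norm D u).
  by apply: le_trans (ip_mx_CauchySchwarz _ _) _ => //; apply: ler_wpM2l => //; exact: norm0_mx_ge0.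
have H2 : `|ip_mx Om r.2 (scaled theta u)| <= Z_norm D r * (lambda2 * Z_norm D theta * X_norm D u).
  by apply: le_trans (ip_mx_CauchySchwarz _ _) _ => //; apply: ler_wpM2l => //; exact: norm0_mx_ge0.
rewrite mulrC ler_pdivrMr //; apply: (le_trans (ler_normB _ _)).
by apply: (le_trans (lerD H1 H2)); lra.
Qed.

(** Common domain of the estimates: the velocity lies in $H^1_0$ for the sake of the embeddings,
    while the current and its divergence enter through $L^2$. *)
Definition flow_L2 (Phi : flow_pair R d) : Prop :=
  X Phi.1 /\ (Lp_mx Om 2 Phi.2.1 /\ Lp Om 2 Phi.2.2).

Definition pressure_L2 (chi : pressure_pair R d) : Prop :=
  Lp Om 2 chi.1 /\ Lp Om 2 chi.2.

Lemma A0Bl eta eta' Phi : flow_L2 eta -> flow_L2 eta' -> flow_L2 Phi ->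
  A0 D (eta - eta') Phi = A0 D eta Phi - A0 D eta' Phi.
Proof.
case: eta eta' Phi => [u J] [u' J'] [v K] [/= Xu [LJ _]] [/= Xu' [LJ' _]] [/= Xv [LK _]].
rewrite /A0 /a_s /a_m /= !d_formE BcrossB /=.
have [_ L1] := H10_vec_Lp Xu; have [_ L2] := H10_vec_Lp Xu'.
have [_ L3] := H10_vec_Lp Xv; have [L4 _] := padded_bound LJ.
have [L5 _] := padded_bound LJ'; have [L6 _] := padded_bound LK.
have [L7 _] := Bcross_bound Xv; have [L8 _] := Bcross_bound Xu.
have [L9 _] := Bcross_bound Xu'.
by rewrite paddedB ip_mxBr // !ip_mxBl //; ring.
Qed.

Lemma d_form_bound K v : Lp_mx Om 2 K.1 -> X v ->
  `|d_form D K v| <= kappa D * lambda1 * B3 * (norm0_mx Om K.1 * X_norm D v).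
Proof.
move=> LK Xv; rewrite d_formE normrM normrN.
have [_ [_ _ k0] _ _ _] := hD; rewrite (gtr0_norm k0).
have [L1 b1] := padded_bound LK; have [L2 b2] := Bcross_bound Xv.
have := ler_pM (norm0_mx_ge0 _ _) (norm0_mx_ge0 _ _) b1 b2.
move/(le_trans (ip_mx_CauchySchwarz L1 L2)) => H.
rewrite -!mulrA ler_pM2l //; apply: le_trans H _.
by lra.
Qed.

Lemma norm0_mx_le_div_norm K : norm0_mx Om K.1 <= div_norm D K.
Proof.
rewrite -[leLHS]ger0_norm ?norm0_mx_ge0 // -sqrtr_sqr; apply: ler_wsqrtr.
by rewrite lerDl sqr_ge0.
Qed.

Lemma X_norm_le_flow_norm Phi : X_norm D Phi.1 <= flow_norm D Phi.
Proof.
rewrite -[leLHS]ger0_norm ?norm0_mx_ge0 // -sqrtr_sqr; apply: ler_wsqrtr.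
by rewrite lerDl sqr_ge0.
Qed.

Lemma flow_norm_sqr Phi : flow_norm D Phi ^+ 2 = X_norm D Phi.1 ^+ 2 + div_norm D Phi.2 ^+ 2.
Proof. by rewrite sqr_sqrtr // addr_ge0 // sqr_ge0. Qed.

Lemma flow_norm_ge0 Phi : 0 <= flow_norm D Phi.
Proof. exact: sqrtr_ge0. Qed.

(** Each factor satisfies $(a_1+a_2)^2\le2(a_1^2+a_2^2)$. This is the origin of the factor 2 in
    [Cmax]. *)
Lemma two_dim_sum_le (a1 a2 a b1 b2 b : R) : 0 <= a1 -> 0 <= a2 -> 0 <= a ->
  0 <= b1 -> 0 <= b2 -> 0 <= b ->
  a ^+ 2 = a1 ^+ 2 + a2 ^+ 2 -> b ^+ 2 = b1 ^+ 2 + b2 ^+ 2 ->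
  (a1 + a2) * (b1 + b2) <= 2 * (a * b).
Proof.
move=> a10 a20 a0 b10 b20 b0 ea eb.
rewrite -ler_sqr ?nnegrE ?mulr_ge0 ?addr_ge0 // !exprMn ea eb.
have -> : 2 ^+ 2 * ((a1 ^+ 2 + a2 ^+ 2) * (b1 ^+ 2 + b2 ^+ 2)) =
  (2 * (a1 ^+ 2 + a2 ^+ 2)) * (2 * (b1 ^+ 2 + b2 ^+ 2)) :> R by ring.
apply: ler_pM; rewrite ?sqr_ge0 // -subr_ge0.
  by rewrite (_ : _ - _ = (a1 - a2) ^+ 2) ?sqr_ge0 //; ring.
by rewrite (_ : _ - _ = (b1 - b2) ^+ 2) ?sqr_ge0 //; ring.
Qed.

(** The four terms match the four products in $(\|\nabla u\|_0+\|J\|_0)(\|\nabla v\|_0+\|K\|_0)$,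
    each with a coefficient at most the maximum [m]. *)
Lemma A0_bound eta Phi : flow_L2 eta -> flow_L2 Phi ->
  `|A0 D eta Phi| <= Cmax D lambda1 * flow_norm D eta * flow_norm D Phi.
Proof.
case: eta Phi => [u J] [v K] [/= Xu [LJ _]] [/= Xv [LK _]].
rewrite /A0 /a_s /a_m /=.
have [_ [p0 _ k0] _ _ _] := hD.
have [_ Lu] := H10_vec_Lp Xu; have [_ Lv] := H10_vec_Lp Xv.
set m := Num.max (Num.max (Pr D) (kappa D)) (kappa D * lambda1 * B3).
have mP : Pr D <= m by rewrite /m !le_max lexx.
have mk : kappa D <= m by rewrite /m !le_max lexx orbT.
have mB : kappa D * lambda1 * B3 <= m by rewrite /m !le_max lexx !orbT.
have m0 : 0 <= m by exact: le_trans (ltW p0) mP.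
have NJ := norm0_mx_ge0 Om J.1; have NK := norm0_mx_ge0 Om K.1.
have Nu := X_norm_ge0 D u; have Nv := X_norm_ge0 D v.
have S1 : `|Pr D * ip_mx Om u.2 v.2| <= m * (X_norm D u * X_norm D v).
  by rewrite normrM (gtr0_norm p0) ler_pM ?(ltW p0) //; exact: ip_mx_CauchySchwarz.
have S2 : `|kappa D * ip_mx Om J.1 K.1| <= m * (norm0_mx Om J.1 * norm0_mx Om K.1).
  by rewrite normrM (gtr0_norm k0) ler_pM ?(ltW k0) //; exact: ip_mx_CauchySchwarz.
have S3 : `|d_form D J v| <= m * (norm0_mx Om J.1 * X_norm D v).
  by apply: le_trans (d_form_bound LJ Xv) _; rewrite ler_wpM2r // mulr_ge0.
have S4 : `|d_form D K u| <= m * (norm0_mx Om K.1 * X_norm D u).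
  by apply: le_trans (d_form_bound LK Xu) _; rewrite ler_wpM2r // mulr_ge0.
apply: (le_trans (ler_normB _ _)); apply: (le_trans (lerD (ler_normD _ _) S4)).
apply: (le_trans (lerD (lerD (ler_normD _ _) S3) (lexx _))).
apply: (le_trans (lerD (lerD (lerD S1 S2) (lexx _)) (lexx _))).
have -> : m * (X_norm D u * X_norm D v) + m * (norm0_mx Om J.1 * norm0_mx Om K.1) +
   m * (norm0_mx Om J.1 * X_norm D v) + m * (norm0_mx Om K.1 * X_norm D u) =
   m * ((X_norm D u + norm0_mx Om J.1) * (X_norm D v + norm0_mx Om K.1)) by ring.
have -> : Cmax D lambda1 * flow_norm D (u, J) * flow_norm D (v, K) =
   m * (2 * (flow_norm D (u, J) * flow_norm D (v, K))) by rewrite /Cmax -/m; ring.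
rewrite ler_wpM2l //.
have dJ := norm0_mx_le_div_norm J; have dK := norm0_mx_le_div_norm K.
apply: (@le_trans _ _ ((X_norm D u + div_norm D J) * (X_norm D v + div_norm D K))).
  by apply: ler_pM; [exact: addr_ge0|exact: addr_ge0|rewrite lerD2l|rewrite lerD2l].
have e1 := flow_norm_sqr (u, J); have e2 := flow_norm_sqr (v, K).
apply: two_dim_sum_le e1 e2; rewrite ?flow_norm_ge0 //; exact: sqrtr_ge0.
Qed.

Lemma ipBl (f g h : E -> R) : Lp Om 2 f -> Lp Om 2 g -> Lp Om 2 h ->
  ip Om (f - g) h = ip Om f h - ip Om g h.
Proof.
move=> Lf Lg Lh; rewrite /ip -Rintegral_OmB; [|exact: Lp_mul..].
by apply: eq_Rintegral => x _; rewrite !fctE mulrBl.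
Qed.

Lemma ipC (f g : E -> R) : ip Om f g = ip Om g f.
Proof. by apply: eq_Rintegral => x _; rewrite mulrC. Qed.

Lemma ipBr (f g h : E -> R) : Lp Om 2 f -> Lp Om 2 g -> Lp Om 2 h ->
  ip Om h (f - g) = ip Om h f - ip Om h g.
Proof. by move=> Lf Lg Lh; rewrite !(ipC h) ipBl. Qed.

Lemma Lp_trace (F : E -> 'M[R]_d) : Lp_mx Om 2 F -> Lp Om 2 (fun x => \tr (F x)).
Proof. by move=> LF; apply: Lp_sum_fun => [|i]; [rewrite ler1n|exact: LF]. Qed.

Lemma BformBl chi chi' Phi : pressure_L2 chi -> pressure_L2 chi' -> flow_L2 Phi ->
  Bform D (chi - chi') Phi = Bform D chi Phi - Bform D chi' Phi.
Proof.
move=> [L1 L2] [L1' L2'] [Xv [_ LK]]; have [_ /Lp_trace Lv] := H10_vec_Lp Xv.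
rewrite /Bform /b_s /b_m.
have -> : (chi - chi').1 = chi.1 - chi'.1 by [].
have -> : (chi - chi').2 = chi.2 - chi'.2 by [].
by rewrite !ipBl //; ring.
Qed.

Lemma BformBr chi Phi Phi' : pressure_L2 chi -> flow_L2 Phi -> flow_L2 Phi' ->
  Bform D chi (Phi - Phi') = Bform D chi Phi - Bform D chi Phi'.
Proof.
move=> [L1 L2] [Xv [_ LK]] [Xv' [_ LK']].
have [_ /Lp_trace Lv] := H10_vec_Lp Xv; have [_ /Lp_trace Lv'] := H10_vec_Lp Xv'.
rewrite /Bform /b_s /b_m.
have -> : (fun x => \tr ((Phi - Phi').1.2 x)) =
    (fun x => \tr (Phi.1.2 x)) - (fun x => \tr (Phi'.1.2 x)).
  by apply/funext => x; rewrite !fctE /= raddfB.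
have -> : (Phi - Phi').2.2 = Phi.2.2 - Phi'.2.2 by [].
by rewrite !ipBr //; ring.
Qed.

Lemma e_formB theta theta' r : Z theta -> Z theta' -> Z r ->
  e_form D (theta - theta') r = e_form D theta r - e_form D theta' r.
Proof.
by move=> /H10_Lp[_ L1] /H10_Lp[_ L2] /H10_Lp[_ L3]; rewrite /e_form ip_mxBl.
Qed.

Lemma e_form_self r : Z r -> e_form D r r = Z_norm D r ^+ 2.
Proof. by move=> /H10_Lp[_ L]; rewrite /Z_norm norm0_mx_sqr. Qed.

Definition buoyancy (theta : h1_scalar R d) : E -> E :=
  fun x => theta.1 x *: 'e_(idir D).

Lemma buoyancy_bound theta : Z theta -> Lp_mx Om 2 (buoyancy theta) /\
  norm0_mx Om (buoyancy theta) <= COm * Z_norm D theta.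
Proof.
move=> Zt; have [L1 _] := H10_Lp Zt.
have n1 : mxnorm ('e_(idir D) : E) = 1.
  rewrite /mxnorm /mxdot big_ord1 (bigD1 (idir D)) //= !mxE !eqxx mulr1 big1 ?addr0 ?sqrtr1 //.
  by move=> j /negbTE jd; rewrite !mxE jd andbF mulr0.
have Lb : Lp_mx Om 2 (buoyancy theta).
  move=> i j; have p1 : 1 <= 2 :> R by rewrite ler1n.
  have := LpZ (('e_(idir D) : E) i j) p1 L1; congr (Lp _ _ _).
  by apply/funext => x; rewrite !mxE mulrC.
split => //; case: hemb => _ _ _ _ /(_ _ Zt)[h _ _]; apply: le_trans h.
have LN := Lp_mxnorm (ler1n R 2) Lb.
rewrite -lee_fin !Lp_normE //; apply: Lp_enorm_le => //.
- exact: Lp_measurable LN.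
- exact: Lp_measurable L1.
- by move=> x; rewrite mxnormZ n1 mulr1 normr_id.
Qed.

(** Poincare's inequality is used once for the temperature and once for the velocity, whence
    [COm ^+ 2] in [lambda_q]. *)
Lemma Qform_bound theta Phi : Z theta -> X Phi.1 ->
  `|Qform D theta Phi| <= lambda_q D COm * Z_norm D theta * X_norm D Phi.1.
Proof.
move=> Zt Xv; rewrite /Qform normrN normrM.
have [_ [p0 r0 _] _ _ _] := hD; rewrite gtr0_norm ?mulr_gt0 //.
have [Lb bb] := buoyancy_bound Zt; have [Lv _] := H10_vec_Lp Xv.
case: hemb => _ _ _ /(_ _ Xv)[bv _ _] _.
have := ler_pM (norm0_mx_ge0 _ _) (norm0_mx_ge0 _ _) bb bv.
move/(le_trans (ip_mx_CauchySchwarz Lb Lv)) => H.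
rewrite /lambda_q -!mulrA !ler_pM2l //; apply: le_trans H _.
by lra.
Qed.

Lemma QformB theta theta' Phi : Z theta -> Z theta' -> X Phi.1 ->
  Qform D (theta - theta') Phi = Qform D theta Phi - Qform D theta' Phi.
Proof.
move=> Zt Zt' Xv; rewrite /Qform.
have [Lb _] := buoyancy_bound Zt; have [Lb' _] := buoyancy_bound Zt'.
have [Lv _] := H10_vec_Lp Xv.
have -> : (fun x => (theta - theta').1 x *: 'e_(idir D)) = buoyancy theta - buoyancy theta'.
  by apply/funext => x; rewrite !fctE /= scalerBl.
by rewrite ip_mxBl //; ring.
Qed.

End form_linearity.

(** * Dual norms as suprema, and spans *)

Section dual_norms.
Context {R : realType}.

(** If [N] vanishes on [X], the set of quotients is empty and its [sup] is 0; [0 <= K] covers this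
    case. *)
Lemma dual_norm_le (V : Type) (N : V -> R) (X : set V) (F : V -> R) (K : R) :
  (forall v, 0 <= N v) -> 0 <= K -> (forall v, X v -> F v <= K * N v) ->
  dual_norm N X F <= K.
Proof.
move=> N0 K0 FK; rewrite /dual_norm.
have [->|/set0P A0] := eqVneq [set F v / N v | v in X `&` [set v | N v != 0]] set0.
  by rewrite sup0.
apply: ge_sup A0 _ => _ [v [Xv /= Nv] <-].
by rewrite ler_pdivrMr ?FK // lt_def Nv N0.
Qed.

(** Continuity of [F] bounds the quotients above, so that [sup] is a genuine supremum, and forces
    [F v <= 0] where [N v] vanishes. *)
Lemma le_dual_norm (V : lmodType R) (N : V -> R) (X : set V) (F : V -> R) :
  (forall v, 0 <= N v) -> is_dual N X F ->
  forall v, X v -> F v <= dual_norm N X F * N v.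
Proof.
move=> N0 [_ [C FC]] v Xv; have [Nv|Nv] := eqVneq (N v) 0.
  by have := FC v Xv; rewrite Nv !mulr0; exact/le_trans/ler_norm.
have Npos w : N w != 0 -> 0 < N w by rewrite lt_def N0 andbT.
rewrite -ler_pdivrMr ?Npos //; apply: ub_le_sup; last by exists v.
exists C => _ [w [Xw /= Nw] <-].
by rewrite ler_pdivrMr ?Npos //; exact: le_trans (ler_norm _) (FC _ Xw).
Qed.

(** Adding the bounds at [v] and [- v] cancels the values of [F]. *)
Lemma dual_norm_ge0 (V : lmodType R) (N : V -> R) (X : set V) (F : V -> R) :
  (forall v, 0 <= N v) -> (forall v, N (- v) = N v) ->
  (forall v, X v -> X (- v)) -> is_dual N X F -> 0 <= dual_norm N X F.
Proof.
move=> N0 NN XN Fdual; have [lin _] := Fdual.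
have [A0|/set0P[_ [v [Xv /= Nv] _]]] :=
    eqVneq [set F v / N v | v in X `&` [set v | N v != 0]] set0.
  by rewrite /dual_norm A0 sup0.
have FN : F (- v) = - F v.
  (* Linearity is available for expressions [a *: u + v], hence this way of writing [- v]. *)
  have -> : - v = (- 2) *: v + v by rewrite -[X in _ + X]scale1r -scalerDl -scaleN1r; congr (_ *: _); ring.
  by rewrite lin //; ring.
have h1 := le_dual_norm N0 Fdual Xv.
have := le_dual_norm N0 Fdual (XN _ Xv); rewrite NN FN => h2.
have : 0 <= dual_norm N X F * N v by lra.
by rewrite pmulr_lge0 // lt_def Nv N0.
Qed.

(** The discrete spaces are given as spans; this closure property lets errors serve as test
    functions. *)
Lemma fin_dimB (V : lmodType R) (X : set V) : fin_dim X ->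
  forall u v, X u -> X v -> X (u - v).
Proof.
move=> [n [b ->]] _ _ [c _ <-] [c' _ <-]; exists (fun i => c i - c' i) => //.
by rewrite -sumrB; apply: eq_bigr => i _; rewrite scalerBl.
Qed.

End dual_norms.

(** * Stability of $H^1_0$ under change of sign *)

Section H10_opposite.
Context {R : realType} {d : nat} (Om : set 'rV[R]_d).
Local Notation E := 'rV[R]_d.

Lemma iter_partialN (phi : E -> R) s : smooth phi ->
  iter_partial s (- phi) = - iter_partial s phi.
Proof.
move=> sphi; elim: s => //= i s ->.
by apply/funext => x; rewrite deriveN //; have [_] := sphi s.
Qed.

Lemma test_funN (phi : E -> R) : test_fun Om phi -> test_fun Om (- phi).
Proof.
move=> [sphi [K KOm phi0]]; split; last first.
  by exists K => // x /phi0; rewrite fctE => ->; rewrite oppr0.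
move=> s; rewrite iter_partialN //; have [c dphi] := sphi s; split.
  by move=> x; apply: continuousN; exact: c.
by move=> i x; apply: derivableN; exact: dphi.
Qed.

Lemma gradN (phi : E -> R) x : test_fun Om phi -> grad (- phi) x = - grad phi x.
Proof.
move=> [sphi _]; apply/rowP => i; rewrite !mxE deriveN //.
by have [_] := sphi [::]; apply.
Qed.

Lemma norm0N (f : E -> R) : norm0 Om (- f) = norm0 Om f.
Proof.
rewrite /norm0 /Lp_norm /Lp_enorm restrictN; congr fine.
exact: (oppe_Lnorm _ (EFin \o f \_ Om)).
Qed.

Lemma norm0_mxN m n (F : E -> 'M[R]_(m, n)) : norm0_mx Om (- F) = norm0_mx Om F.
Proof.
rewrite /norm0_mx; congr norm0; apply/funext => x; rewrite fctE.
by rewrite -scaleN1r mxnormZ normrN1 mul1r.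
Qed.

(** The approximating test functions are negated along with [z]. *)
Lemma H10N (z : h1_scalar R d) : H10 Om z -> H10 Om (- z).
Proof.
have p1 : 1 <= 2 :> R by rewrite ler1n.
move=> [[L1 L2 weak] dense]; split; [split => /=|].
- exact: LpN.
- move=> i j; have := LpN p1 (L2 i j); congr (Lp _ _ _).
  by apply/funext => x; rewrite !fctE mxE.
(* Testing with [- phi] moves the sign pointwise inside the integrands, so that linearity of the
   integral is avoided. *)
- move=> phi tphi i; have := weak _ (test_funN tphi) i.
  rewrite /ip => H; transitivity (\int[lebesgue_rV d]_(x in Om) (z.1 x * grad (- phi) x 0 i)).
    apply: eq_Rintegral => x _; rewrite (gradN _ tphi).
    by rewrite [in RHS]mxE mulrN -mulNr.
  rewrite H; congr (- _); apply: eq_Rintegral => x _.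
  by rewrite fctE mulrN -mulNr; congr (_ * _); rewrite mxE.
- move=> eps /dense[phi tphi [h1 h2]]; exists (- phi); first exact: test_funN.
  split.
    rewrite -norm0N; move: h1; congr (norm0 Om _ < _).
    by apply/funext => x; rewrite !fctE /= !fctE; ring.
  rewrite -norm0_mxN; move: h2; congr (norm0_mx Om _ < _).
  by apply/funext => x; rewrite !fctE /= (gradN _ tphi) !fctE opprB opprK addrC.
Qed.

End H10_opposite.

(** * A priori bounds and one step of the error recursion *)

Section oseen_iteration.
Context {R : realType} {d : nat} (D : problem_data R d).
Context (hD : well_posed_data D) (COm lambda1 lambda2 : R).
Context (hemb : embedding_constants D COm lambda1 lambda2).
Context (V : fe_spaces R d) (hV : conforming D V).
Local Notation Om := (Omega D).
Local Notation X := (H10_vec Om).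
Local Notation Z := (H10 Om).
Local Notation L := (L_norm D).
Local Notation lq := (lambda_q D COm).
Local Notation lphi := (lambda_phi D).
Local Notation Cm := (Cmin D).
Local Notation M := ((L + lq * lphi) / Cm).
Local Notation s := (sigma D COm lambda2).
Implicit Types (Phi eta : flow_pair R d) (chi xi : pressure_pair R d).
Implicit Types (r theta : h1_scalar R d).

(** A supremum of signed quotients is not nonnegative by form; the symmetry of $H^1_0$ makes it
    so. *)
Lemma lambda_phi_ge0 : 0 <= lphi.
Proof.
have [_ _ _ _ dual] := hD; apply: dual_norm_ge0 dual => [r|r|r].
- exact: Z_norm_ge0.
- exact: norm0_mxN.
- exact: H10N.
Qed.

Lemma phisrc_le r : Z r -> phisrc D r <= lphi * Z_norm D r.
Proof. by have [_ _ _ _ dual] := hD; apply: le_dual_norm dual _ => w; exact: Z_norm_ge0. Qed.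

Lemma Cmin_gt0 : 0 < Cm.
Proof. by have [_ [p0 _ k0] _ _ _] := hD; rewrite lt_min p0. Qed.

Lemma L_norm_ge0 : 0 <= L.
Proof. exact: sqrtr_ge0. Qed.

Lemma lambda_q_ge0 : 0 <= lq.
Proof.
have [_ [p0 r0 _] _ _ _] := hD.
by rewrite mulr_ge0 ?sqr_ge0 // ltW // mulr_gt0.
Qed.

Lemma stability_bound_ge0 : 0 <= M.
Proof.
rewrite divr_ge0 ?(ltW Cmin_gt0) // addr_ge0 ?L_norm_ge0 //.
by rewrite mulr_ge0 ?lambda_q_ge0 ?lambda_phi_ge0.
Qed.

Lemma sigmaE : s = lambda2 * M / Cm + lambda2 * M.
Proof. by rewrite /sigma; field; rewrite gt_eqF ?Cmin_gt0. Qed.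

Lemma lambda2_ge0 : 0 <= lambda2.
Proof. by case: hemb => _ _ /ltW. Qed.

Lemma lambda2M_le_sigma : lambda2 * M <= s.
Proof.
rewrite sigmaE lerDr divr_ge0 ?(ltW Cmin_gt0) //.
by rewrite mulr_ge0 ?lambda2_ge0 ?stability_bound_ge0.
Qed.

Lemma sigma_ge0 : 0 <= s.
Proof. by apply: le_trans lambda2M_le_sigma; rewrite mulr_ge0 ?lambda2_ge0 ?stability_bound_ge0. Qed.

(** In the flow error the first summand pays for convection and the second for buoyancy, because
    [Cm * M = L + lq * lphi] dominates [lq * lphi]. *)
Lemma sigma_Cmin : s * Cm = lambda2 * M + Cm * (lambda2 * M).
Proof. by rewrite sigmaE; field; rewrite gt_eqF ?Cmin_gt0. Qed.

Lemma Dh_flow_L2 Phi : Dh V Phi -> flow_L2 D Phi.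
Proof.
case: hV => -[[_ XV] [_ YV] _ _ _] _ [/XV XPhi /YV [[L1 L2 _] _]].
by split.
Qed.

Lemma Gh_pressure_L2 chi : Gh V chi -> pressure_L2 D chi.
Proof. by case: hV => -[_ _ [_ EV] [_ SV] _] _ [/EV[L1 _] /SV[L2 _]]. Qed.

Lemma Zh_H10 r : Zh V r -> Z r.
Proof. by case: hV => -[_ _ _ _ [_ ZV]] _ /ZV. Qed.

Lemma DhB Phi eta : Dh V Phi -> Dh V eta -> Dh V (Phi - eta).
Proof.
case: hV => -[[fX _] [fY _] _ _ _] _ [x1 y1] [x2 y2].
by split; [exact: (fin_dimB fX)|exact: (fin_dimB fY)].
Qed.

Lemma GhB chi xi : Gh V chi -> Gh V xi -> Gh V (chi - xi).
Proof.
case: hV => -[_ _ [fX _] [fY _] _] _ [x1 y1] [x2 y2].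
by split; [exact: (fin_dimB fX)|exact: (fin_dimB fY)].
Qed.

Lemma ZhB r theta : Zh V r -> Zh V theta -> Zh V (r - theta).
Proof. by case: hV => -[_ _ _ _ [fZ _]] _; exact: fin_dimB. Qed.

(** The pressure pair $(0,\psi)$, with $\psi$ equal to the divergence almost everywhere, is
    admissible and turns the constraint into $\|\nabla\cdot J\|_0^2=0$. *)
Lemma norm0_div_eq0 chi Phi : Gh V chi -> Dh V Phi ->
  (forall chi, Gh V chi -> Bform D chi Phi = 0) -> norm0 Om Phi.2.2 = 0.
Proof.
move=> Gchi DPhi B0; case: (hV) => _ /(_ _ DPhi.2)[psi Spsi Kpsi].
have [_ [_ LK]] := Dh_flow_L2 DPhi.
have Gpsi : Gh V (chi.1, psi) by split => //; exact: Gchi.1.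
have Lpsi : Lp Om 2 psi by have [] := Gh_pressure_L2 Gpsi.
(* The zero element of [Eh] is produced as [chi.1 - chi.1]. *)
have G0 := GhB Gpsi Gpsi.
have Gpsi0 : Gh V (chi.1 - chi.1, psi) by split => //; exact: G0.1.
have := B0 _ Gpsi0; rewrite /Bform /b_s /b_m /=.
have -> : ip Om (chi.1 - chi.1) (fun x => \tr (Phi.1.2 x)) = 0.
  rewrite subrr /ip; under eq_Rintegral do rewrite mul0r.
  by rewrite Rintegral_mkcond /Rintegral integral0_eq // => x _; rewrite restrictE; case: ifP.
rewrite mulr0 add0r => /eqP; rewrite mulf_eq0 oppr_eq0.
have [_ [_ _ k0] _ _ _] := hD; rewrite gt_eqF //= => /eqP psiK.
apply/eqP; rewrite -sqrf_eq0 norm0_sqr // -psiK; apply/eqP.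
apply: Rintegral_Om_ae.
- by apply: measurable_onM; exact: Lp_measurable LK.
- by apply: measurable_onM; [exact: Lp_measurable Lpsi|exact: Lp_measurable LK].
- by apply: filterS Kpsi => x Kpsi Omx; rewrite Kpsi.
Qed.

(** The two coupling terms cancel on the diagonal, and for a vanishing divergence the div-norm is
    the $L^2$ norm, which [a_m] controls. *)
Lemma A0_coercive Phi : flow_L2 D Phi -> norm0 Om Phi.2.2 = 0 ->
  Cm * flow_norm D Phi ^+ 2 <= A0 D Phi Phi.
Proof.
move=> [/H10_vec_Lp[_ Lv] [LK _]] div0; rewrite /A0 addrK.
rewrite /a_s /a_m -!norm0_mx_sqr // flow_norm_sqr /div_norm.
rewrite sqr_sqrtr ?addr_ge0 ?sqr_ge0 // div0 expr0n addr0 mulrDr.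
by apply: lerD; apply: ler_wpM2r; rewrite ?sqr_ge0 // ge_min lexx ?orbT.
Qed.

Lemma le_of_quadratic (c n S : R) : 0 < c -> 0 <= n -> 0 <= S ->
  c * n ^+ 2 <= S * n -> n <= S / c.
Proof.
move=> c0 n0 S0; have [->|nz] := eqVneq n 0; first by rewrite divr_ge0 // ltW.
by rewrite expr2 mulrA ler_pM2r ?lt_def ?nz // ler_pdivlMr // mulrC.
Qed.

(** Cauchy-Schwarz in the plane: the squared sides differ by the perfect square displayed in the
    proof. *)
Lemma Lform_le Phi : flow_L2 D Phi -> Lform D Phi <= L * flow_norm D Phi.
Proof.
move=> [Xv [LK _]]; have [_ [_ _ k0] _ [fdual Lg] _] := hD.
have h1 : fsrc D Phi.1 <= f_dual_norm D * X_norm D Phi.1.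
  by apply: le_dual_norm fdual _ Xv => v; exact: X_norm_ge0.
have h2 : kappa D * ip_mx Om (gsrc D) Phi.2.1 <=
    kappa D * norm0_mx Om (gsrc D) * div_norm D Phi.2.
  rewrite -mulrA ler_pM2l // (le_trans (ler_norm _)) //.
  rewrite (le_trans (ip_mx_CauchySchwarz _ _)) //.
  by rewrite ler_wpM2l ?norm0_mx_ge0 // norm0_mx_le_div_norm.
apply: (le_trans (lerD h1 h2)).
rewrite /L_norm /flow_norm -sqrtrM; last by rewrite addr_ge0 ?sqr_ge0 // -exprMn sqr_ge0.
apply: le_trans (ler_norm _) _; rewrite -sqrtr_sqr; apply: ler_wsqrtr.
rewrite -subr_ge0.
rewrite (_ : _ - _ = (f_dual_norm D * div_norm D Phi.2 -
  kappa D * norm0_mx Om (gsrc D) * X_norm D Phi.1) ^+ 2) ?sqr_ge0 //.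
by ring.
Qed.

(** Convective terms vanish on the diagonal and are left out, so this serves the discrete solution,
    the initial value and every iterate. *)
Lemma energy_bound eta xi theta : Dh V eta -> Gh V xi -> Zh V theta ->
  A0 D eta eta + Bform D xi eta + Qform D theta eta = Lform D eta ->
  (forall chi, Gh V chi -> Bform D chi eta = 0) ->
  e_form D theta theta = phisrc D theta ->
  Z_norm D theta <= lphi /\ flow_norm D eta <= M.
Proof.
move=> De Gx /Zh_H10 Zt eq1 div0 eq2; have Le := Dh_flow_L2 De.
have Zn : Z_norm D theta <= lphi.
  (* The form [e_form] is coercive with constant 1, hence the division by 1. *)
  rewrite -[lphi]divr1; apply: le_of_quadratic; rewrite ?Z_norm_ge0 ?lambda_phi_ge0 //.
  by rewrite mul1r -e_form_self // eq2; exact: phisrc_le.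
split => //; apply: le_of_quadratic; rewrite ?Cmin_gt0 ?flow_norm_ge0 //.
  by rewrite addr_ge0 ?L_norm_ge0 // mulr_ge0 ?lambda_q_ge0 ?lambda_phi_ge0.
apply: le_trans (A0_coercive Le (norm0_div_eq0 Gx De div0)) _.
have -> : A0 D eta eta = Lform D eta - Qform D theta eta.
  by rewrite -eq1 div0 // addr0 addrK.
rewrite mulrDl; apply: lerD; first exact: Lform_le.
apply: le_trans (ler_norm _) _; rewrite normrN.
apply: le_trans (Qform_bound hD hemb Zt Le.1) _.
rewrite -mulrA -mulrA ler_wpM2l ?lambda_q_ge0 //.
apply: ler_pM; rewrite ?Z_norm_ge0 ?X_norm_ge0 //; exact: X_norm_le_flow_norm.
Qed.

Lemma A1_bound w eta Phi (a b : R) : flow_L2 D w -> flow_L2 D eta -> flow_L2 D Phi ->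
  flow_norm D w <= a -> flow_norm D eta <= b ->
  `|A1 D w eta Phi| <= lambda2 * a * b * flow_norm D Phi.
Proof.
move=> Lw Le LP wa eb; apply: le_trans (c_form_bound hemb Lw.1 Le.1 LP.1) _.
have wa' := le_trans (X_norm_le_flow_norm D w) wa.
have eb' := le_trans (X_norm_le_flow_norm D eta) eb.
rewrite -!mulrA ler_wpM2l ?lambda2_ge0 //.
by do 2 (apply: ler_pM; rewrite ?mulr_ge0 ?X_norm_ge0 //); exact: X_norm_le_flow_norm.
Qed.

Lemma H_bound w theta r (a b : R) : flow_L2 D w -> Z theta -> Z r ->
  flow_norm D w <= a -> Z_norm D theta <= b ->
  `|Hform D w theta r| <= lambda2 * a * b * Z_norm D r.
Proof.
move=> Lw Zt Zr wa tb; apply: le_trans (h_form_bound hemb Lw.1 Zt Zr) _.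
have wa' := le_trans (X_norm_le_flow_norm D w) wa.
rewrite ler_wpM2r ?Z_norm_ge0 // -!mulrA ler_wpM2l ?lambda2_ge0 //.
by apply: ler_pM; rewrite ?X_norm_ge0 ?Z_norm_ge0.
Qed.

(* [T] and [Y] stand for the convective terms of the iterate, which are zero for
   the initial value; [s ^+ k * M] bounds the error in the convecting velocity. *)
Lemma error_step beta (eta_h eta : flow_pair R d) (xi_h xi : pressure_pair R d)
    (theta_h theta : h1_scalar R d) (T : flow_pair R d -> R)
    (Y : h1_scalar R d -> R) (k : nat) :
  s < 1 -> inf_sup D V beta ->
  discrete_solution D V eta_h xi_h theta_h ->
  Dh V eta -> Gh V xi -> Zh V theta ->
  (forall Phi chi r, Dh V Phi -> Gh V chi -> Zh V r ->
    [/\ A0 D eta Phi + T Phi + Bform D xi Phi + Qform D theta Phi = Lform D Phi,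
      Bform D chi eta = 0 & e_form D theta r + Y r = phisrc D r]) ->
  let z := eta_h - eta in
  `|A1 D eta_h eta_h z - T z| <= lambda2 * (s ^+ k * M) * M * flow_norm D z ->
  (forall Phi, Dh V Phi -> `|A1 D eta_h eta_h Phi - T Phi| <=
    (lambda2 * (s ^+ k * M) * M + lambda2 * M * flow_norm D z) * flow_norm D Phi) ->
  (let zt := theta_h - theta in `|Hform D eta_h theta_h zt - Y zt| <=
    lambda2 * (s ^+ k * M) * lphi * Z_norm D zt) ->
  [/\ flow_norm D z <= s ^+ k.+1 * M,
    Z_norm D (theta_h - theta) <= s ^+ k.+1 * lphi &
    beta * pressure_norm D (xi_h - xi) <=
      (Cmax D lambda1 + 3 * Cm) * s ^+ k.+1 * M].
Proof.
move=> s1 his [Dh1 Gh1 Zh1 sol1] Dh2 Gh2 Zh2 sol2 z Tz TP YP.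
have Dz : Dh V z by exact: DhB.
have Gz : Gh V (xi_h - xi) by exact: GhB.
have Zz : Zh V (theta_h - theta) by exact: ZhB.
have Lz := Dh_flow_L2 Dz; have L1 := Dh_flow_L2 Dh1; have L2 := Dh_flow_L2 Dh2.
have P1 := Gh_pressure_L2 Gh1; have P2 := Gh_pressure_L2 Gh2.
have Z1 := Zh_H10 Zh1; have Z2 := Zh_H10 Zh2; have Zz' := Zh_H10 Zz.
have M0 := stability_bound_ge0; have C0 := Cmin_gt0; have s0 := sigma_ge0.
have l20 := lambda2_ge0; have lq0 := lambda_q_ge0; have lp0 := lambda_phi_ge0.
have L0 := L_norm_ge0; have sk0 : 0 <= s ^+ k by exact: exprn_ge0.
have sC := sigma_Cmin; have l2s := lambda2M_le_sigma.
have MC : M * Cm = L + lq * lphi by rewrite divfK // gt_eqF.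
have Qb (Phi : flow_pair R d) : Dh V Phi -> `|Qform D (theta_h - theta) Phi| <=
    lq * Z_norm D (theta_h - theta) * flow_norm D Phi.
  move=> DP; have [XP _] := Dh_flow_L2 DP.
  apply: le_trans (Qform_bound hD hemb Zz' XP) _.
  by rewrite (ler_wpM2l (mulr_ge0 lq0 (Z_norm_ge0 D _))) // X_norm_le_flow_norm.
(* From here on [M] and [lq] are opaque and known only through the facts just recorded. *)
set q := lq in lq0 Qb MC; set m := M in M0 sC l2s MC Tz TP YP *; clearbody m q.
(* The temperature error is tested with itself, which leaves the convective mismatch bounded by
   [YP]. *)
have Zb0 : Z_norm D (theta_h - theta) <= lambda2 * (s ^+ k * m) * lphi.
  rewrite -[leRHS]divr1; apply: le_of_quadratic; rewrite ?Z_norm_ge0 ?mulr_ge0 //.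
  rewrite mul1r -e_form_self // e_formB //.
  have [_ _ e1] := sol1 _ _ _ Dz Gz Zz; have [_ _ e2] := sol2 _ _ _ Dz Gz Zz.
  have -> : e_form D theta_h (theta_h - theta) - e_form D theta (theta_h - theta) =
      - (Hform D eta_h theta_h (theta_h - theta) - Y (theta_h - theta)).
    by apply/eqP; rewrite -subr_eq0; apply/eqP; lra.
  by apply: le_trans (ler_norm _) _; rewrite normrN; exact: YP.
have div0 chi : Gh V chi -> Bform D chi z = 0.
  move=> Gc; have [_ B1 _] := sol1 _ _ _ Dz Gc Zz; have [_ B2 _] := sol2 _ _ _ Dz Gc Zz.
  by rewrite BformBr ?B1 ?B2 ?subr0 //; exact: Gh_pressure_L2.
(* Difference of the two flow equations, in which the load cancels. *)
have err Phi : Dh V Phi -> A0 D z Phi + (A1 D eta_h eta_h Phi - T Phi) +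
    Bform D (xi_h - xi) Phi + Qform D (theta_h - theta) Phi = 0.
  move=> DP; have LP := Dh_flow_L2 DP.
  have [e1 _ _] := sol1 _ _ _ DP Gz Zz; have [e2 _ _] := sol2 _ _ _ DP Gz Zz.
  rewrite (A0Bl hD hemb) // BformBl // (QformB hemb) //; last exact: LP.1.
  by lra.
(* The additional power of [s] comes from [lambda2 * M <= s]. *)
have Zb : Z_norm D (theta_h - theta) <= s ^+ k.+1 * lphi.
  apply: le_trans Zb0 _; rewrite ler_wpM2r // exprSr.
  by rewrite mulrCA ler_wpM2l.
have zb : flow_norm D z <= s ^+ k.+1 * m.
  have zb0 : flow_norm D z <=
      (lambda2 * (s ^+ k * m) * m + q * (lambda2 * (s ^+ k * m) * lphi)) / Cm.
    apply: le_of_quadratic; rewrite ?flow_norm_ge0 //.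
      by rewrite addr_ge0 // !mulr_ge0.
    apply: le_trans (A0_coercive Lz (norm0_div_eq0 Gz Dz div0)) _.
    have := err z Dz; rewrite div0 // addr0 => ez.
    have -> : A0 D z z = - (A1 D eta_h eta_h z - T z) - Qform D (theta_h - theta) z by lra.
    apply: le_trans (ler_norm _) _; apply: le_trans (ler_normB _ _) _.
    rewrite normrN mulrDl lerD // (le_trans (Qb z Dz)) //.
    by rewrite ler_wpM2r ?flow_norm_ge0 // ler_wpM2l.
  apply: le_trans zb0 _; rewrite ler_pdivrMr //.
  (* Once $s^kM$ is taken out, what is left is
     $\lambda_2M+\lambda_2\lambda_q\lambda_\varphi\le\lambda_2M+C_{\min}\lambda_2M=\sigma
     C_{\min}$. *)
  have -> : lambda2 * (s ^+ k * m) * m + q * (lambda2 * (s ^+ k * m) * lphi) =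
    s ^+ k * m * (lambda2 * m + lambda2 * (q * lphi)) by ring.
  have -> : s ^+ k.+1 * m * Cm = s ^+ k * m * (s * Cm) by rewrite exprSr; ring.
  rewrite ler_wpM2l ?mulr_ge0 // sC lerD2l [leRHS]mulrCA ler_wpM2l //.
  by rewrite [leRHS]mulrC MC lerDr.
split => //.
have Cmax0 : 0 <= Cmax D lambda1.
  by have [_ [p0 _ _] _ _ _] := hD; rewrite /Cmax mulr_ge0 // !le_max (ltW p0).
have K0 : 0 <= (Cmax D lambda1 + 3 * Cm) * s ^+ k.+1 * m.
  apply: mulr_ge0 => //; apply: mulr_ge0; last exact: exprn_ge0.
  by apply: addr_ge0 => //; apply: mulr_ge0 => //; exact: ltW.
(* By the inf-sup condition it suffices to bound the other terms of the error equation for every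
   test flow. *)
apply: le_trans (his _ Gz) _; apply: dual_norm_le => // [Phi|Phi DP].
  exact: flow_norm_ge0.
have LP := Dh_flow_L2 DP; have := err Phi DP => eP.
have -> : Bform D (xi_h - xi) Phi =
  - A0 D z Phi - (A1 D eta_h eta_h Phi - T Phi) - Qform D (theta_h - theta) Phi by lra.
apply: le_trans (ler_norm _) _; apply: le_trans (ler_normB _ _) _.
apply: le_trans (lerD (ler_normB _ _) (Qb _ DP)) _.
rewrite normrN.
apply: le_trans (lerD (lerD (A0_bound hD hemb Lz LP) (TP _ DP)) (lexx _)) _.
rewrite -!mulrDl ler_wpM2r ?flow_norm_ge0 //.
(* Here [b1] yields [Cmax], while [b2], [b3] and [b4] yield one [Cm] each: for the error in the
   convecting velocity, for that in the convected velocity, and for buoyancy. *)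
have b1 : Cmax D lambda1 * flow_norm D z <= Cmax D lambda1 * (s ^+ k.+1 * m) by rewrite ler_wpM2l.
have l2sC : lambda2 * m <= s * Cm by rewrite sC lerDl !mulr_ge0 // ltW.
have b2 : lambda2 * (s ^+ k * m) * m <= Cm * (s ^+ k.+1 * m).
  have -> : lambda2 * (s ^+ k * m) * m = s ^+ k * m * (lambda2 * m) by ring.
  have -> : Cm * (s ^+ k.+1 * m) = s ^+ k * m * (s * Cm) by rewrite exprSr; ring.
  by rewrite ler_wpM2l ?mulr_ge0.
(* The assumption [s < 1] enters here: $\lambda_2M\le\sigma C_{\min}\le C_{\min}$. *)
have b3 : lambda2 * m * flow_norm D z <= Cm * (s ^+ k.+1 * m).
  apply: ler_pM; rewrite ?flow_norm_ge0 ?mulr_ge0 //.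
  by apply: le_trans l2sC _; rewrite ger_pMl // ltW.
have b4 : q * Z_norm D (theta_h - theta) <= Cm * (s ^+ k.+1 * m).
  apply: le_trans (ler_wpM2l lq0 Zb) _.
  have -> : Cm * (s ^+ k.+1 * m) = s ^+ k.+1 * (m * Cm) by ring.
  by rewrite mulrCA ler_wpM2l ?exprn_ge0 // MC lerDr.
apply: le_trans (lerD (lerD b1 (lerD b2 b3)) b4) _.
by lra.
Qed.

End oseen_iteration.

(** * Stability of all iterates, and induction on the iteration index for the errors *)

Theorem theorem4p4 (R : realType) (d : nat) (hd : d = 2%N \/ d = 3%N)
  (D : problem_data R d) (hD : well_posed_data D)
  (COm lambda1 lambda2 : R) (hemb : embedding_constants D COm lambda1 lambda2)
  (meshsize : set R) (hmesh : forall h, meshsize h -> 0 < h)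
  (V : R -> fe_spaces R d)
  (hV : forall h, meshsize h -> conforming D (V h))
  (beta_s beta_m beta : R)
  (hbeta_s : 0 < beta_s) (hbeta_m : 0 < beta_m) (hbeta : 0 < beta)
  (his : forall h, meshsize h -> inf_sup_s D (V h) beta_s)
  (him : forall h, meshsize h -> inf_sup_m D (V h) beta_m)
  (hisup : forall h, meshsize h -> inf_sup D (V h) beta)
  (hsigma : sigma D COm lambda2 < 1)
  (h : R) (hh : meshsize h)
  (eta_h : flow_pair R d) (xi_h : pressure_pair R d) (theta_h : h1_scalar R d)
  (hsol : discrete_solution D (V h) eta_h xi_h theta_h)
  (eta : nat -> flow_pair R d) (xi : nat -> pressure_pair R d)
  (theta : nat -> h1_scalar R d)
  (hinit : initial_solution D (V h) (eta 0%N) (xi 0%N) (theta 0%N))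
  (hstep : forall n : nat,
     oseen_step D (V h) (eta n) (eta n.+1) (xi n.+1) (theta n.+1)) :
  let s := sigma D COm lambda2 in
  let M := (L_norm D + lambda_q D COm * lambda_phi D) / Cmin D in
  (forall n : nat, Z_norm D (theta n) <= lambda_phi D /\
     flow_norm D (eta n) <= M) /\
  (forall n : nat,
     [/\ flow_norm D (eta_h - eta n) <= s ^+ n.+1 * M,
       Z_norm D (theta_h - theta n) <= s ^+ n.+1 * lambda_phi D &
       beta * pressure_norm D (xi_h - xi n)
         <= (Cmax D lambda1 + 3 * Cmin D) * s ^+ n.+1 * M]).
Proof.
move=> s M; have hVh := hV h hh; have isup := hisup h hh.
have [Dh_h Gh_h Zh_h eq_h] := hsol.
(* These bounds enter the error source, in which [eta_h] and [theta_h] are the convected fields. *)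
have [th_h eta_hM] : Z_norm D theta_h <= lambda_phi D /\ flow_norm D eta_h <= M.
  have [e1 _ e3] := eq_h _ _ _ Dh_h Gh_h Zh_h.
  apply: (energy_bound hD hemb hVh Dh_h Gh_h Zh_h).
  - by move: e1; rewrite /A1 c_form_self addr0.
  - by move=> chi Gc; have [] := eq_h _ _ _ Dh_h Gc Zh_h.
  - by move: e3; rewrite /Hform h_form_self addr0.
have in_spaces n : [/\ Dh (V h) (eta n), Gh (V h) (xi n) & Zh (V h) (theta n)].
  by case: n => [|n]; [case: hinit|case: (hstep n)].
have stable n : Z_norm D (theta n) <= lambda_phi D /\ flow_norm D (eta n) <= M.
  have [Dn Gn Zn] := in_spaces n.
  case: n Dn Gn Zn => [|n] Dn Gn Zn; apply: (energy_bound hD hemb hVh Dn Gn Zn).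
  - by case: hinit => _ _ _ /(_ _ _ _ Dn Gn Zn)[].
  - by move=> chi Gc; case: hinit => _ _ _ /(_ _ _ _ Dn Gc Zn)[].
  - by case: hinit => _ _ _ /(_ _ _ _ Dn Gn Zn)[].
  - case: (hstep n) => _ _ _ /(_ _ _ _ Dn Gn Zn)[+ _ _].
    by rewrite /A1 c_form_self addr0.
  - by move=> chi Gc; case: (hstep n) => _ _ _ /(_ _ _ _ Dn Gc Zn)[].
  - case: (hstep n) => _ _ _ /(_ _ _ _ Dn Gn Zn)[_ _].
    by rewrite /Hform h_form_self addr0.
split=> //.
have L_h := Dh_flow_L2 hVh Dh_h; have Zt_h := Zh_H10 hVh Zh_h.
have M0 : 0 <= M := stability_bound_ge0 hD COm.
have l20 := lambda2_ge0 hemb.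
elim=> [|n [IH _ _]].
  have [D0 G0 Z0] := in_spaces 0%N.
  have Dz := DhB hVh Dh_h D0; have Lz := Dh_flow_L2 hVh Dz.
  (* Index [k = 0]: the error in the convecting velocity is [eta_h] itself, bounded by $M=s^0M$. *)
  apply: (error_step hD hemb hVh (T := fun=> 0) (Y := fun=> 0)
    hsigma isup hsol D0 G0 Z0) => /=.
  - move=> Phi chi r DP Gc Zr; case: hinit => _ _ _ /(_ _ _ _ DP Gc Zr)[e1 e2 e3].
    by rewrite !addr0.
  - by rewrite subr0 expr0 mul1r; exact: (A1_bound hemb).
  - move=> Phi DP; have LP := Dh_flow_L2 hVh DP.
    rewrite subr0 expr0 mul1r; apply: le_trans (A1_bound hemb L_h L_h LP eta_hM eta_hM) _.
    rewrite ler_wpM2r ?flow_norm_ge0 // lerDl.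
    exact: mulr_ge0 (mulr_ge0 l20 M0) (flow_norm_ge0 D _).
  - rewrite subr0 expr0 mul1r; apply: (H_bound hemb) => //.
    exact: (Zh_H10 hVh (ZhB hVh Zh_h Z0)).
have [Dn Gn Zn] := in_spaces n; have [Dn1 Gn1 Zn1] := in_spaces n.+1.
have Dz := DhB hVh Dh_h Dn1; have Lz := Dh_flow_L2 hVh Dz.
have Dz' := DhB hVh Dh_h Dn; have Lz' := Dh_flow_L2 hVh Dz'.
have Ln := Dh_flow_L2 hVh Dn; have Ln1 := Dh_flow_L2 hVh Dn1.
have [_ etaM] := stable n; have [thM _] := stable n.+1.
have Zt1 := Zh_H10 hVh Zn1; have Zz := ZhB hVh Zh_h Zn1.
(* The form with convecting velocity [eta n] and convected field [eta_h] is added and subtracted.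
   The first term carries the preceding error; the second vanishes when tested with the new
   error. *)
have splitA (Phi : flow_pair R d) : Dh (V h) Phi ->
    A1 D eta_h eta_h Phi - A1 D (eta n) (eta n.+1) Phi =
    A1 D (eta_h - eta n) eta_h Phi + A1 D (eta n) (eta_h - eta n.+1) Phi.
  move=> DP; have LP := Dh_flow_L2 hVh DP.
  rewrite /A1 (c_formBl hemb L_h.1 Ln.1 L_h.1 LP.1).
  by rewrite (c_formBm hemb Ln.1 L_h.1 Ln1.1 LP.1); ring.
have Zzt := Zh_H10 hVh Zz.
(* Index [k = n.+1]: [IH] bounds the preceding error by $s^{n+1}M$, and one more power is gained. *)
apply: (error_step hD hemb hVh (T := A1 D (eta n) (eta n.+1))
    (Y := Hform D (eta n) (theta n.+1)) hsigma isup hsol Dn1 Gn1 Zn1) => /=.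
- by case: (hstep n).
- by rewrite splitA // [X in _ + X]c_form_self addr0; exact: (A1_bound hemb).
(* For a general test flow the second term of [splitA] survives; there [eta n] is bounded by [M]
   through stability. *)
- move=> Phi DP; have LP := Dh_flow_L2 hVh DP; rewrite splitA // mulrDl.
  apply: le_trans (ler_normD _ _) _; apply: lerD; first exact: (A1_bound hemb).
  exact: (A1_bound hemb).
- have -> : Hform D eta_h theta_h (theta_h - theta n.+1) -
      Hform D (eta n) (theta n.+1) (theta_h - theta n.+1) =
      Hform D (eta_h - eta n) theta_h (theta_h - theta n.+1) +
      Hform D (eta n) (theta_h - theta n.+1) (theta_h - theta n.+1).
    rewrite /Hform (h_formBl hemb L_h.1 Ln.1 Zt_h Zzt).
    by rewrite (h_formBm hemb Ln.1 Zt_h Zt1 Zzt); ring.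
  by rewrite [X in _ + X]h_form_self addr0; exact: (H_bound hemb).
Qed.
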